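(* Let $n\ge1$ and let $A\in\mathbb{R}^{2n\times 2n}$ be a real symmetric Hamiltonian matrix. The following algorithm converges locally quadratically to any nondegenerate critical point $P^{*}$ of the Rayleigh quotient function $f:\mathrm{LG}_n\to\mathbb{R}$, $f(P)=\operatorname{tr}(AP)$. Algorithm. Pick $\Theta_0\in\mathrm{OSp}_{2n}$ and put $P_0=\Theta_0^{\top}\begin{bmatrix}I_n&0\\0&0\end{bmatrix}\Theta_0\in\mathrm{LG}_n$. For $j=0,1,2,\dots$: (i) compute the $n\times n$ blocks $\begin{bmatrix}A_{11}&A_{12}\\ A_{12}&-A_{11}\end{bmatrix}=\Theta_jA\Theta_j^{\top}$; (ii) solve the Lyapunov equation $A_{11}Z_j+Z_jA_{11}=-A_{12}$ for a symmetric matrix $Z_j\in\mathbb{R}^{n\times n}$; (iii) set $\Theta_{j+1}^{\top}=\Theta_j^{\top}\begin{bmatrix}I_n&Z_j\\-Z_j&I_n\end{bmatrix}_{Q}$ and $P_{j+1}=\Theta_{j+1}^{\top}\begin{bmatrix}I_n&0\\0&0\end{bmatrix}\Theta_{j+1}$.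
   Context: Let $J=\begin{bmatrix}0&I_n\\-I_n&0\end{bmatrix}$. The Lagrange Grassmannian is $\mathrm{LG}_n=\{P\in\mathbb{R}^{2n\times2n}:P^{\top}=P,\ P^2=P,\ \operatorname{tr}P=n,\ PJP=0\}$, a smooth compact submanifold, of dimension $n(n+1)/2$, of the space of real symmetric $2n\times2n$ matrices. $\mathrm{OSp}_{2n}=\{T\in\mathrm{SO}_{2n}:T^{\top}JT=J\}$. A real symmetric Hamiltonian matrix is one of the form $\begin{bmatrix}S&T\\ T&-S\end{bmatrix}$ with $S,T\in\mathbb{R}^{n\times n}$ symmetric. For symmetric $Z$, $\begin{bmatrix}I_n&Z\\-Z&I_n\end{bmatrix}_Q:=\begin{bmatrix}R^{-1}&ZR^{-1}\\-ZR^{-1}&R^{-1}\end{bmatrix}$, where $R$ is the unique upper triangular matrix with positive diagonal satisfying $R^{\top}R=I_n+Z^2$ (this is the orthogonal factor of the QR factorization with positive diagonal). A critical point is nondegenerate if the Hessian of $f$ there is nondegenerate. ''The algorithm converges locally quadratically to $P^{*}$'' means: there are a neighborhood $V\subset\mathrm{LG}_n$ of $P^{*}$ and a constant $C$ such that, for every $\Theta_0\in\mathrm{OSp}_{2n}$ with $P_0\in V$, all steps are well defined (the Lyapunov equations are uniquely solvable in symmetric matrices), $P_j\to P^{*}$, and $\|P_{j+1}-P^{*}\|\le C\|P_j-P^{*}\|^2$ for all $j$. *)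

(* Defs.v *)
From mathcomp Require Import all_boot all_order all_algebra.
From mathcomp Require Import all_classical all_reals all_analysis.

Set Implicit Arguments.
Unset Strict Implicit.
Unset Printing Implicit Defensive.

Import Order.TTheory GRing.Theory Num.Theory.
Import numFieldNormedType.Exports.

Local Open Scope ring_scope.
Local Open Scope classical_set_scope.

(** Critical points and Hessians on an embedded submanifold [M] of a space of
    matrices, expressed through smooth curves in [M]. *)

Definition smooth_curve (R : realType) (m : nat) (g : R -> 'M[R]_m) : Prop :=
  forall (k : nat) (t : R), derivable (g^`(k)) t 1.

Definition curve_through (R : realType) (m : nat) (M : set 'M[R]_m)
    (P : 'M[R]_m) (g : R -> 'M[R]_m) : Prop :=
  [/\ smooth_curve g, forall t, M (g t) & g 0 = P].

Definition tangent (R : realType) (m : nat) (M : set 'M[R]_m)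
    (P : 'M[R]_m) : set 'M[R]_m :=
  [set xi | exists2 g, curve_through M P g & g^`() 0 = xi].

Definition critical_point (R : realType) (m : nat) (M : set 'M[R]_m)
    (f : 'M[R]_m -> R) (P : 'M[R]_m) : Prop :=
  M P /\
  forall g, curve_through M P g -> is_derive (0 : R) (1 : R) (f \o g) (0 : R).

(** At a critical point [P], the Hessian is the symmetric bilinear form [H] on
    the tangent space with [H (g' 0) (g' 0) = (f o g)'' 0] for every smooth
    curve [g] in [M] through [P]; criticality makes the right-hand side depend
    on [g' 0] only, and polarization makes [H] unique on the tangent space.
    Values of [H] outside the tangent space are irrelevant. *)
Definition is_hessian (R : realType) (m : nat) (M : set 'M[R]_m)
    (f : 'M[R]_m -> R) (P : 'M[R]_m) (H : 'M[R]_m -> 'M[R]_m -> R) : Prop :=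
  [/\ forall xi eta, tangent M P xi -> tangent M P eta -> H xi eta = H eta xi,
      forall (a : R) xi zeta eta,
        tangent M P xi -> tangent M P zeta -> tangent M P eta ->
        H (a *: xi + zeta) eta = a * H xi eta + H zeta eta
    & forall g, curve_through M P g ->
        is_derive (0 : R) (1 : R) ((f \o g)^`()) (H (g^`() 0) (g^`() 0))].

Definition nondegenerate_critical_point (R : realType) (m : nat)
    (M : set 'M[R]_m) (f : 'M[R]_m -> R) (P : 'M[R]_m) : Prop :=
  critical_point M f P /\
  exists2 H, is_hessian M f P H &
    forall xi, tangent M P xi ->
      (forall eta, tangent M P eta -> H xi eta = 0) -> xi = 0.

Definition Jmx (R : realType) (n : nat) : 'M[R]_(n + n) :=
  block_mx 0 1%:M (- 1%:M) 0.

Definition LG (R : realType) (n : nat) : set 'M[R]_(n + n) :=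
  [set P | [/\ P^T = P, P *m P = P, \tr P = n%:R & P *m Jmx R n *m P = 0]].

Definition OSp (R : realType) (n : nat) : set 'M[R]_(n + n) :=
  [set T | [/\ T^T *m T = 1%:M, \det T = 1 & T^T *m Jmx R n *m T = Jmx R n]].

Definition symmetric_hamiltonian (R : realType) (n : nat)
    (A : 'M[R]_(n + n)) : Prop :=
  exists S T : 'M[R]_n, [/\ S^T = S, T^T = T & A = block_mx S T T (- S)].

Definition rayleigh (R : realType) (n : nat) (A P : 'M[R]_(n + n)) : R :=
  \tr (A *m P).

Definition proj_of (R : realType) (n : nat) (Theta : 'M[R]_(n + n)) :
    'M[R]_(n + n) :=
  Theta^T *m block_mx (1%:M : 'M[R]_n) 0 0 (0 : 'M[R]_n) *m Theta.

Definition lyapunov_solution (R : realType) (n : nat)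
    (A Theta : 'M[R]_(n + n)) (Z : 'M[R]_n) : Prop :=
  let B := Theta *m A *m Theta^T in
  Z^T = Z /\ ulsubmx B *m Z + Z *m ulsubmx B = - ursubmx B.

Definition qr_triangular (R : realType) (n : nat) (Z U : 'M[R]_n) : Prop :=
  [/\ forall i j : 'I_n, (j < i)%N -> U i j = 0,
      forall i : 'I_n, 0 < U i i
    & U^T *m U = 1%:M + Z *m Z].

Definition qr_orthogonal (R : realType) (n : nat) (Z U : 'M[R]_n) :
    'M[R]_(n + n) :=
  block_mx (invmx U) (Z *m invmx U) (- (Z *m invmx U)) (invmx U).

Definition newton_step (R : realType) (n : nat)
    (A Theta Theta' : 'M[R]_(n + n)) : Prop :=
  exists Z U : 'M[R]_n,
    [/\ lyapunov_solution A Theta Z, qr_triangular Z U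
      & Theta'^T = Theta^T *m qr_orthogonal Z U].

Definition newton_run (R : realType) (n : nat) (A Theta0 : 'M[R]_(n + n))
    (Theta : nat -> 'M[R]_(n + n)) : Prop :=
  Theta 0%N = Theta0 /\ forall j, newton_step A (Theta j) (Theta j.+1).

(** [`| _ |] is the library norm on matrices (largest absolute value of an
    entry); by equivalence of norms its choice only affects the constant [C].
    The statement [within LG (nbhs Pstar) V] says that [V] is a neighborhood
    of [Pstar] in the subspace topology of [LG]. *)
Definition locally_quadratically_convergent (R : realType) (n : nat)
    (A Pstar : 'M[R]_(n + n)) : Prop :=
  exists (V : set 'M[R]_(n + n)) (C : R),
    [/\ V `<=` @LG R n,
        within (@LG R n) (nbhs Pstar) V
      & forall Theta0, @OSp R n Theta0 -> V (proj_of Theta0) ->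
          (exists Theta, newton_run A Theta0 Theta) /\
          forall Theta, newton_run A Theta0 Theta ->
            [/\ forall j, exists! Z : 'M[R]_n, lyapunov_solution A (Theta j) Z,
                (fun j => proj_of (Theta j)) @ \oo --> Pstar
              & forall j, `|proj_of (Theta j.+1) - Pstar|
                          <= C * `|proj_of (Theta j) - Pstar| ^+ 2]].

(* Main.v *)
Require Import Defs.
From HB Require Import structures.
From mathcomp Require Import all_boot all_order all_algebra.
From mathcomp Require Import all_classical all_reals all_analysis.
From mathcomp Require Import ring lra.

(** At a Lagrangian projection [P], the tangent space of [LG] consists of the
    symmetric [X] with [J X = - X J] and [X P + P X = X].  Every such [X] is the
    velocity of the curve [t |-> (1 + tX) P (1 + tX) (1 + t^2 X^2)^-1], whose
    entries are rational functions of [t].  Differentiating [tr (A _)] along it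
    once gives [A P = P A] at a critical point, and twice gives the Hessian
    [H X Y = - tr ((S X + X S) Y)] with [S = P A + A P - A], so nondegeneracy
    says that [X |-> S X + X S] is injective on the tangent space.  In the frame
    of [Theta] this map is the Lyapunov operator, hence the latter is boundedly
    invertible uniformly in all [Theta] with [proj_of Theta] near [P].

    In such a frame, with [E = diag (1, 0)], [P* = [a b; b 1-a]] and
    [A = [s t; t -s]], idempotency gives [1 - a = b^2 + (1 - a)^2], which is
    quadratic in [P* - E], and [A P* = P* A] gives [s b + b s = a t + t a - t].
    Hence the Lyapunov solution [Z] satisfies
    [s (Z + b) + (Z + b) s = - (1 - a) t - t (1 - a)], so [Z = - b] up to a
    quadratic error, and the new projection [[G -GZ; -ZG ZGZ]] with
    [G = (1 + Z^2)^-1] agrees with [P*] up to a quadratic error. *)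

Set Implicit Arguments.
Unset Strict Implicit.
Unset Printing Implicit Defensive.

Import Order.TTheory GRing.Theory Num.Theory.
Import numFieldNormedType.Exports.

Local Open Scope ring_scope.
Local Open Scope classical_set_scope.

(* Abelian group identities with matrix products as atoms; [set] rather than
   [generalize], as occurrences may differ by convertible instances. *)
Ltac mx_abel :=
  repeat match goal with |- context [@mulmx ?R ?m ?n ?p ?A ?B] =>
    let x := fresh "x" in set x := (@mulmx R m n p A B); clearbody x end;
  repeat match goal with |- context [Jmx ?R ?n] =>
    let x := fresh "x" in set x := (Jmx R n); clearbody x end;
  apply/matrixP => ? ?; rewrite !mxE; ring.

(** * The entrywise maximum norm, Gram matrices, and injective linear maps between matrix spaces *)

Section MatrixNorm.
Variable R : realType.

Lemma mx_norm_le p q (M : 'M[R]_(p, q)) (c : R) :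
  0 <= c -> (forall i j, `|M i j| <= c) -> `|M| <= c.
Proof.
move=> c0 h; rewrite /Num.Def.normr/= mx_normrE.
by apply: bigmax_le => // -[i j] _; exact: h.
Qed.

Lemma le_mx_norm p q (M : 'M[R]_(p, q)) i j : `|M i j| <= `|M|.
Proof.
rewrite [leRHS]/Num.Def.normr/= mx_normrE.
by apply/bigmax_geP; right; exists (i, j).
Qed.

Lemma mx_norm_mul p q r (M : 'M[R]_(p, q)) (N : 'M[R]_(q, r)) :
  `|M *m N| <= q%:R * (`|M| * `|N|).
Proof.
apply: mx_norm_le => [|i j]; first by rewrite !mulr_ge0.
rewrite mxE (le_trans (ler_norm_sum _ _ _))//.
have -> : q%:R * (`|M| * `|N|) = \sum_(k < q) (`|M| * `|N|).
  by rewrite sumr_const card_ord mulr_natl.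
by apply: ler_sum => k _; rewrite normrM ler_pM// le_mx_norm.
Qed.

Lemma mx_norm_mul_le p q r (M : 'M[R]_(p, q)) (N : 'M[R]_(q, r)) (x y : R) :
  `|M| <= x -> `|N| <= y -> `|M *m N| <= q%:R * (x * y).
Proof.
move=> Mx Ny; apply: (le_trans (mx_norm_mul _ _)).
by rewrite ler_wpM2l// ler_pM.
Qed.

Lemma mx_norm_mul1l_le p q r (M : 'M[R]_(p, q)) (N : 'M[R]_(q, r)) :
  `|M| <= 1 -> `|M *m N| <= q%:R * `|N|.
Proof. by move=> M1; rewrite -[X in _ * X]mul1r mx_norm_mul_le. Qed.

Lemma mx_norm_mul1r_le p q r (M : 'M[R]_(p, q)) (N : 'M[R]_(q, r)) :
  `|N| <= 1 -> `|M *m N| <= q%:R * `|M|.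
Proof. by move=> N1; rewrite -[X in _ * X]mulr1 mx_norm_mul_le. Qed.

Lemma mx_norm_tr p q (M : 'M[R]_(p, q)) : `|M^T| = `|M|.
Proof.
apply/eqP; rewrite eq_le; apply/andP; split;
  apply: mx_norm_le => // i j; first by rewrite mxE le_mx_norm.
by have := le_mx_norm M^T j i; rewrite mxE.
Qed.

Lemma mx_norm_mxvec p q (M : 'M[R]_(p, q)) : `|mxvec M| = `|M|.
Proof.
apply/eqP; rewrite eq_le; apply/andP; split; apply: mx_norm_le => // i j.
  case/mxvec_indexP: j => k l; rewrite ord1 mxvecE; exact: le_mx_norm.
rewrite -(mxvecE M); exact: le_mx_norm.
Qed.

Lemma mx_norm_block m1 m2 n1 n2 (a : 'M[R]_(m1, n1)) (b : 'M[R]_(m1, n2))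
    (c : 'M[R]_(m2, n1)) (d : 'M[R]_(m2, n2)) (x : R) :
  0 <= x -> `|a| <= x -> `|b| <= x -> `|c| <= x -> `|d| <= x ->
  `|block_mx a b c d| <= x.
Proof.
move=> x0 ax bx cx dx; apply: mx_norm_le => // i j.
rewrite -(splitK i) -(splitK j).
case: (fintype.split i) => i'; case: (fintype.split j) => j' /=;
  by rewrite ?(block_mxEul, block_mxEur, block_mxEdl, block_mxEdr)
             (le_trans (le_mx_norm _ _ _)).
Qed.

Lemma mx_norm_ursubmx m1 m2 n1 n2 (M : 'M[R]_(m1 + m2, n1 + n2)) :
  `|ursubmx M| <= `|M|.
Proof. by apply: mx_norm_le => // i j; rewrite !mxE le_mx_norm. Qed.

Lemma mx_norm_ulsubmx m1 m2 n1 n2 (M : 'M[R]_(m1 + m2, n1 + n2)) :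
  `|ulsubmx M| <= `|M|.
Proof. by apply: mx_norm_le => // i j; rewrite !mxE le_mx_norm. Qed.

Lemma mxtrace_trmul_ge0 p q (M : 'M[R]_(p, q)) : 0 <= \tr (M^T *m M).
Proof.
apply: sumr_ge0 => i _; rewrite mxE; apply: sumr_ge0 => j _.
by rewrite mxE -expr2 sqr_ge0.
Qed.

Lemma mxtrace_trmul_eq0 p q (M : 'M[R]_(p, q)) : \tr (M^T *m M) = 0 -> M = 0.
Proof.
move=> h; apply/matrixP => i j; rewrite mxE.
have sq k l : M^T l k * M k l = M k l ^+ 2 by rewrite mxE expr2.
have h1 : (M^T *m M) j j = 0.
  apply: (psumr_eq0P _ h) => // k _; rewrite mxE; apply: sumr_ge0 => l _.
  by rewrite sq sqr_ge0.
rewrite mxE in h1.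
have : M^T j i * M i j = 0.
  by apply: (psumr_eq0P _ h1) => // l _; rewrite sq sqr_ge0.
by rewrite sq => /eqP; rewrite sqrf_eq0 => /eqP.
Qed.

(** Each diagonal entry of [M^T *m M] is the sum of the squares of a column of [M], so no entry of
    that column exceeds 1 in absolute value. *)
Lemma mx_norm_orthogonal p q (M : 'M[R]_(p, q)) : M^T *m M = 1%:M -> `|M| <= 1.
Proof.
move=> h; apply: mx_norm_le => // i j.
have /matrixP/(_ j j) := h; rewrite !mxE eqxx (bigD1 i)//= mxE -expr2 => e.
rewrite -(@ler_pXn2r _ 2)// ?nnegrE// expr1n real_normK ?num_real//.
rewrite -[leRHS]e lerDl; apply: sumr_ge0 => k _.
by rewrite mxE -expr2 sqr_ge0.
Qed.

(** A row vector [v] killed by [1 + M M^T] satisfies [v v^T + (v M) (v M)^T = 0]; both traces are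
    nonnegative, so [v] vanishes. *)
Lemma unitmx_add1_gram p q (M : 'M[R]_(p, q)) : 1%:M + M *m M^T \in unitmx.
Proof.
rewrite -row_free_unit; apply/inj_row_free => v.
rewrite mulmxDr mulmx1 => h.
have h2 : v *m v^T + (v *m M) *m (v *m M)^T = 0.
  by rewrite trmx_mul mulmxA -[v *m M *m _]mulmxA -mulmxDl h mul0mx.
have : \tr (v *m v^T) + \tr ((v *m M) *m (v *m M)^T) = 0.
  by rewrite -mxtraceD h2 mxtrace0.
have ge0 r s (N : 'M[R]_(r, s)) : 0 <= \tr (N *m N^T).
  by have := mxtrace_trmul_ge0 N^T; rewrite trmxK.
move/eqP; rewrite paddr_eq0 ?ge0// => /andP[/eqP e _].
by apply: trmx_inj; rewrite trmx0; apply: mxtrace_trmul_eq0; rewrite trmxK.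
Qed.

Lemma row_free_linear_inj p q p' q'
    (f : {linear 'M[R]_(p, q) -> 'M[R]_(p', q')}) :
  (forall M, f M = 0 -> M = 0) -> row_free (lin_mx f).
Proof.
move=> finj; apply/inj_row_free => v; rewrite -[v]vec_mxK mul_vec_lin => h.
by rewrite [vec_mx v]finj ?linear0//; apply/(can_inj mxvecK); rewrite h linear0.
Qed.

(** The matrix of [f] on vectorized arguments is row free, hence has a right inverse; the constant
    is the norm of that inverse times the dimension factor of the product bound. *)
Lemma linear_inj_bounded_below p q p' q' (f : 'M[R]_(p, q) -> 'M[R]_(p', q')) :
  linear f -> (forall M, f M = 0 -> M = 0) ->
  exists2 c : R, 0 <= c & forall M, `|M| <= c * `|f M|.
Proof.
move=> flin finj.
pose F : {linear 'M[R]_(p, q) -> 'M[R]_(p', q')} :=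
  HB.pack f (GRing.isLinear.Build _ _ _ _ f flin).
have rf : row_free (lin_mx F) by exact: row_free_linear_inj.
exists ((p' * q')%:R * `|pinvmx (lin_mx F)|) => [|M]; first by rewrite mulr_ge0.
rewrite -(mx_norm_mxvec M) -[mxvec M]mulmx1 -(mulmxVp rf) mulmxA mul_vec_lin.
by rewrite (le_trans (mx_norm_mul _ _))// mx_norm_mxvec mulrA mulrAC.
Qed.

Lemma linear_inj_surj p q (f : 'M[R]_(p, q) -> 'M[R]_(p, q)) :
  linear f -> (forall M, f M = 0 -> M = 0) -> forall N, exists M, f M = N.
Proof.
move=> flin finj N.
pose F : {linear 'M[R]_(p, q) -> 'M[R]_(p, q)} :=
  HB.pack f (GRing.isLinear.Build _ _ _ _ f flin).
have rf : row_free (lin_mx F) by exact: row_free_linear_inj.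
exists (vec_mx (mxvec N *m invmx (lin_mx F))).
apply/(can_inj mxvecK); rewrite -(mul_vec_lin F) vec_mxK mulmxKV//.
by rewrite -row_free_unit.
Qed.

End MatrixNorm.

(** * Existence of the triangular factor *)

Section Cholesky.
Variable R : realType.

(** The trace only reads the 1 by 1 matrix [x^T M x] as a scalar. *)
Definition posdefmx n (M : 'M[R]_n) : Prop :=
  M^T = M /\ forall x : 'cV[R]_n, x != 0 -> 0 < \tr (x^T *m M *m x).

Lemma posdefmx_add1_sqr n (Z : 'M[R]_n) :
  Z^T = Z -> posdefmx (1%:M + Z *m Z).
Proof.
move=> Zs; split=> [|x x0]; first by rewrite linearD/= trmx1 trmx_mul Zs.
rewrite mulmxDr mulmxDl mulmx1 mxtraceD.
have -> : x^T *m (Z *m Z) *m x = (Z *m x)^T *m (Z *m x).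
  by rewrite trmx_mul Zs !mulmxA.
apply: ltr_wpDr; first exact: mxtrace_trmul_ge0.
rewrite lt_neqAle mxtrace_trmul_ge0 andbT eq_sym.
by apply: contra x0 => /eqP/mxtrace_trmul_eq0 ->.
Qed.

(** Induction on the size: split off the first row and column and factor the Schur complement
    [N - m^-1 v v^T]. *)
Lemma cholesky n (M : 'M[R]_n) : posdefmx M ->
  exists U : 'M[R]_n, [/\ forall i j : 'I_n, (j < i)%N -> U i j = 0,
    forall i, 0 < U i i & U^T *m U = M].
Proof.
elim: n M => [|n ih] M [Ms Mpos].
  by exists 0; split=> [[]//|[]//|]; rewrite thinmx0 [M]thinmx0.
pose m := M 0 0.
pose M1 : 'M[R]_(1 + n) := M.
have M1s : M1^T = M1 by [].
have M1pos (x : 'cV[R]_(1 + n)) : x != 0 -> 0 < \tr (x^T *m M1 *m x) by exact: Mpos.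
pose v := dlsubmx M1; pose N := drsubmx M1.
have ME : M1 = block_mx m%:M v^T v N.
  rewrite -[LHS]submxK; congr block_mx.
    by rewrite [LHS]mx11_scalar !mxE /m; congr (M _ _)%:M; apply/val_inj.
  by rewrite /v trmx_dlsub M1s.
have Ns : N^T = N by rewrite /N trmx_drsub M1s.
have qf (a : R) (x : 'cV[R]_n) : \tr ((col_mx a%:M x)^T *m M1 *m col_mx a%:M x)
    = a ^+ 2 * m + 2 * a * \tr (v^T *m x) + \tr (x^T *m N *m x).
  rewrite ME tr_col_mx mul_row_block mul_row_col tr_scalar_mx.
  rewrite !mulmxDl !mxtraceD.
  rewrite !mul_scalar_mx !mul_mx_scalar -!scalemxAl !linearZ/= mxtrace_scalar.
  have -> : \tr (x^T *m v) = \tr (v^T *m x).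
    by rewrite -mxtrace_tr trmx_mul trmxK.
  by rewrite mulr1n; ring.
have m0 : 0 < m.
  have := M1pos (col_mx 1%:M 0); rewrite qf !(mulmx0, mxtrace0) expr1n mul1r.
  rewrite mulr0 !addr0; apply.
  by apply/eqP => /(congr1 usubmx); rewrite col_mxKu linear0 => /eqP;
    rewrite oner_eq0.
pose u := Num.sqrt m.
have u0 : 0 < u by rewrite sqrtr_gt0.
have uu : u * u = m by rewrite -expr2 sqr_sqrtr// ltW.
have [|U [Ut Ud UU]] := ih (N - m^-1 *: (v *m v^T)).
  split=> [|x x0]; first by rewrite linearB linearZ/= trmx_mul trmxK Ns.
  (* This first coordinate minimizes the quadratic form of [M1] for fixed [x]; completing the
     square, the minimum is the value at [x] of the form of the Schur complement. *)
  have := M1pos (col_mx (- (m^-1 * \tr (v^T *m x)))%:M x).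
  have {}x0 : col_mx (- (m^-1 * \tr (v^T *m x)))%:M x != 0.
    by apply: contra x0 => /eqP/(congr1 dsubmx); rewrite col_mxKd linear0 => ->.
  move=> /(_ x0); rewrite qf mulmxBr mulmxBl linearB/= -scalemxAr -scalemxAl mxtraceZ.
  have -> : \tr (x^T *m (v *m v^T) *m x) = \tr (v^T *m x) ^+ 2.
    rewrite !mulmxA -mulmxA mxtrace_mulC.
    have -> : x^T *m v = (v^T *m x)^T by rewrite trmx_mul trmxK.
    rewrite [v^T *m x]mx11_scalar tr_scalar_mx -scalar_mxM !mxtrace_scalar.
    by rewrite !mulr1n expr2.
  move=> h; apply: (lt_le_trans h); rewrite le_eqVlt; apply/orP; left; apply/eqP.
  by field; rewrite gt_eqF.
pose W : 'M[R]_(1 + n) := block_mx u%:M (u^-1 *: v^T) 0 U.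
have WW : W^T *m W = M1.
  rewrite ME /W tr_block_mx mulmx_block !(trmx0, mul0mx, mulmx0, addr0).
  rewrite tr_scalar_mx -scalar_mxM uu.
  have -> : (u^-1 *: v^T)^T = u^-1 *: v by rewrite linearZ/= trmxK.
  rewrite mul_scalar_mx mul_mx_scalar !scalerA (divff (lt0r_neq0 u0)) !scale1r.
  congr block_mx; rewrite UU -scalemxAl -scalemxAr scalerA -invfM uu.
  by rewrite addrC subrK.
exists W; split.
- move=> i j; rewrite -[i](@splitK 1 n) -[j](@splitK 1 n).
  case: (@fintype.split 1 n i) => i'; case: (@fintype.split 1 n j) => j' /=.
  + by rewrite !ord1.
  + by rewrite ord1.
  + by move=> _; rewrite [LHS]block_mxEdl mxE.
  + by move=> ?; rewrite [LHS]block_mxEdr Ut.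
- move=> i; rewrite -[i](@splitK 1 n); case: (@fintype.split 1 n i) => i' /=.
  + by rewrite [ltRHS]block_mxEul mxE eqxx mulr1n.
  + by rewrite [ltRHS]block_mxEdr.
- exact: WW.
Qed.

End Cholesky.

(** * Derivatives of matrix-valued curves *)

Section MatrixDerivative.
Variable R : realType.

Lemma is_derive_mxP p q (f : R -> 'M[R]_(p, q)) (t : R) (df : 'M[R]_(p, q)) :
  is_derive t (1 : R) f df <->
  forall i j, is_derive t (1 : R) (fun x => f x i j) (df i j).
Proof.
split=> [[fd fE] i j|h].
  have fdij := (derivable_mxP f t 1).1 fd.
  by split; [exact: fdij|rewrite -fE (derive_mx fd) mxE].
have fd : derivable f t 1 by apply/derivable_mxP => i j; case: (h i j).
split=> //; rewrite (derive_mx fd); apply/matrixP => i j; rewrite mxE.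
by case: (h i j).
Qed.

Lemma is_derive_sum_ext n (h : 'I_n -> R -> R) (dh : 'I_n -> R) (t : R) :
  (forall i, is_derive t (1 : R) (h i) (dh i)) ->
  is_derive t (1 : R) (fun x => \sum_(i < n) h i x) (\sum_(i < n) dh i).
Proof.
move=> hd; have -> : (fun x => \sum_(i < n) h i x) = \sum_(i < n) h i.
  by apply/funext => x; rewrite fct_sumE.
exact: is_derive_sum.
Qed.

Lemma is_derive_mulmx p q r (f : R -> 'M[R]_(p, q)) (g : R -> 'M[R]_(q, r))
    (t : R) df dg :
  is_derive t (1 : R) f df -> is_derive t (1 : R) g dg ->
  is_derive t (1 : R) (fun x => f x *m g x) (df *m g t + f t *m dg).
Proof.
move=> /is_derive_mxP fd /is_derive_mxP gd; apply/is_derive_mxP => i j.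
have -> : (fun x => (f x *m g x) i j) = (fun x => \sum_k f x i k * g x k j).
  by apply/funext => x; rewrite mxE.
rewrite !mxE -big_split/=; apply: is_derive_sum_ext => k.
have := is_deriveM (fd i k) (gd k j).
by move/is_derive_eq; apply; rewrite /GRing.scale/= addrC mulrC [X in _ + X]mulrC addrC.
Qed.

Lemma is_derive_mxtrace p (f : R -> 'M[R]_p) (t : R) df :
  is_derive t (1 : R) f df -> is_derive t (1 : R) (fun x => \tr (f x)) (\tr df).
Proof. by move/is_derive_mxP => fd; apply: is_derive_sum_ext => i. Qed.

Lemma is_derive_trmx p q (f : R -> 'M[R]_(p, q)) (t : R) df :
  is_derive t (1 : R) f df -> is_derive t (1 : R) (fun x => (f x)^T) df^T.
Proof.
move/is_derive_mxP => fd; apply/is_derive_mxP => i j; rewrite mxE.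
by under eq_fun do rewrite mxE.
Qed.

Lemma is_derive_unique (V : normedModType R) (f : R -> V) (t : R) (a b : V) :
  is_derive t (1 : R) f a -> is_derive t (1 : R) f b -> a = b.
Proof. by move=> [_ <-] [_ <-]. Qed.

Lemma is_derive1 (V : normedModType R) (f : R -> V) (t : R) :
  derivable f t 1 -> is_derive t (1 : R) f (f^`() t).
Proof. by move=> fd; rewrite derive1E; exact: derivableP. Qed.

End MatrixDerivative.

(** * Smoothness of rational functions whose denominators are powers of one polynomial without real
    zeros *)

Section RationalCurves.
Variables (R : realType) (q : {poly R}).
Hypothesis q0 : forall t, q.[t] != 0.

(** Allowing only powers of the fixed [q] as denominators keeps the class closed under sums,
    products and derivatives, with nonvanishing of [q] as the sole condition. *)
Definition ratfun (f : R -> R) : Prop :=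
  exists (p : {poly R}) (m : nat), f = fun t => p.[t] / q.[t] ^+ m.

Lemma ratfun_horner (p : {poly R}) : ratfun (fun t => p.[t]).
Proof. by exists p, 0%N; apply/funext => t; rewrite expr0 divr1. Qed.

Lemma ratfun_cst (c : R) : ratfun (fun=> c).
Proof. by have := ratfun_horner c%:P; under eq_fun do rewrite hornerC. Qed.

Lemma ratfun_id : ratfun (fun t => t).
Proof. by have := ratfun_horner 'X; under eq_fun do rewrite hornerX. Qed.

Lemma ratfunV : ratfun (fun t => q.[t]^-1).
Proof. by exists 1, 1%N; apply/funext => t; rewrite hornerC expr1 div1r. Qed.

Lemma ratfunD f g : ratfun f -> ratfun g -> ratfun (fun t => f t + g t).
Proof.
move=> [p [m ->]] [p' [m' ->]].
exists (p * q ^+ m' + p' * q ^+ m), (m + m')%N; apply/funext => t.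
rewrite hornerD !hornerM !horner_exp exprD.
by field; rewrite !expf_neq0.
Qed.

Lemma ratfunM f g : ratfun f -> ratfun g -> ratfun (fun t => f t * g t).
Proof.
move=> [p [m ->]] [p' [m' ->]].
exists (p * p'), (m + m')%N; apply/funext => t.
by rewrite hornerM exprD invfM mulrACA.
Qed.

Lemma ratfun_sum n (h : 'I_n -> R -> R) :
  (forall i, ratfun (h i)) -> ratfun (fun t => \sum_(i < n) h i t).
Proof.
elim: n h => [|n ih] h hr.
  by under eq_fun do rewrite big_ord0; exact: ratfun_cst.
by under eq_fun do rewrite big_ord_recr/=; apply: ratfunD => //; exact: ih.
Qed.

Lemma is_derive_ratfun (p : {poly R}) (m : nat) (t : R) :
  is_derive t (1 : R) (fun t => p.[t] / q.[t] ^+ m)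
    ((p^`() * q - m%:R *: (p * q^`())).[t] / q.[t] ^+ m.+1).
Proof.
have qm0 : q.[t] ^+ m != 0 by rewrite expf_neq0.
have qd : is_derive t (1 : R) (fun t => q.[t] ^+ m) ((q ^+ m)^`().[t]).
  have -> : (fun t => q.[t] ^+ m) = horner (q ^+ m).
    by apply/funext => x; rewrite horner_exp.
  exact: is_derive_poly.
have [qd1 qd2] := qd.
have vd : is_derive t (1 : R) (fun t => (q.[t] ^+ m)^-1)
   (- (q.[t] ^+ m) ^- 2 * (q ^+ m)^`().[t]).
  split; first exact: derivableV.
  by rewrite deriveV// qd2.
have := is_deriveM (is_derive_poly p t) vd.
move/is_derive_eq; apply; rewrite /GRing.scale/=.
rewrite deriv_exp hornerMn !(hornerM, hornerD, hornerN, hornerZ) horner_exp.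
(* The derivative of [q ^+ m] contains [q ^+ m.-1], so the exponent [0] is treated apart. *)
case: m qm0 {qd qd1 qd2 vd} => [|m] qm0.
  by rewrite mulr0n expr0 expr1; field; rewrite q0.
rewrite /= -mulr_natr !exprS; field.
by rewrite expf_neq0//= q0.
Qed.

Lemma ratfun_derive f : ratfun f ->
  (forall t, derivable f t 1) /\ ratfun (f^`()).
Proof.
move=> [p [m ->]]; split=> [t|]; first by case: (is_derive_ratfun p m t).
exists (p^`() * q - m%:R *: (p * q^`())), m.+1; apply/funext => t.
by rewrite derive1E; case: (is_derive_ratfun p m t).
Qed.

(** By induction on the order, the entries of every iterated derivative stay rational, hence
    derivable. *)
Lemma ratfun_smooth_curve m (g : R -> 'M[R]_m) :
  (forall i j, ratfun (fun t => g t i j)) -> smooth_curve g.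
Proof.
move=> gr.
suff h k : forall i j, ratfun (fun t => (g^`(k)) t i j).
  by move=> k t; apply/derivable_mxP => i j; case: (ratfun_derive (h k i j)).
elim: k => [|k ih] i j; first exact: gr.
have -> : (fun t => (g^`(k.+1)) t i j) = (fun t => (g^`(k)) t i j)^`().
  apply/funext => t; rewrite derive1nS 2!derive1E derive_mx ?mxE//.
  by apply/derivable_mxP => i' j'; case: (ratfun_derive (ih i' j')).
by case: (ratfun_derive (ih i j)).
Qed.

End RationalCurves.

(** * First and second derivatives at 0 read off from an expansion *)

Section SecondOrder.
Variable R : realType.

Lemma is_derive_at0 (c : R) (h : R -> R) : derivable h 0 1 ->
  is_derive (0 : R) (1 : R) (fun t => c + t * h t) (h 0).
Proof.
move=> /derivableP hd.
have := is_deriveD (is_derive_cst c (0 : R) (1 : R))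
  (is_deriveM (is_derive_id (0 : R) (1 : R)) hd).
by move/is_derive_eq; apply; rewrite /GRing.scale/= mul0r mulr1 !add0r.
Qed.

(** The first derivative is [t * (2 * h t + t * h' t)], which has the form handled by
    [is_derive_at0]; the bracket equals [2 * h 0] at 0. *)
Lemma is_derive2_at0 (q : {poly R}) (c : R) (h : R -> R) :
  (forall t, q.[t] != 0) -> ratfun q h ->
  is_derive (0 : R) (1 : R) ((fun t => c + t ^+ 2 * h t)^`()) (2 * h 0).
Proof.
move=> q0 hr.
have [hd hr'] := ratfun_derive q0 hr; have [hd' _] := ratfun_derive q0 hr'.
have -> : (fun t => c + t ^+ 2 * h t)^`() =
          (fun t => 0 + t * (2 * h t + t * (h^`())%classic t)).
  apply/funext => t; rewrite derive1E.
  have hd1 : is_derive t (1 : R) h ((h^`())%classic t) by exact: is_derive1.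
  have := is_deriveD (is_derive_cst c (t : R) (1 : R))
    (is_deriveM (is_deriveX 2 (is_derive_id (t : R) (1 : R))) hd1).
  case=> _; rewrite /GRing.scale/= => hE; apply: etrans hE _.
  by rewrite !fctE /=; ring.
have -> : 2 * h 0 = 2 * h 0 + 0 * (h^`())%classic 0 by rewrite mul0r addr0.
apply: (@is_derive_at0 0 (fun t => 2 * h t + t * (h^`())%classic t)).
apply: derivableD; apply: derivableM => //.
Qed.

End SecondOrder.

(** * The Lagrange Grassmannian, its tangent spaces and a retraction *)

Section LagrangeGrassmannian.
Variables (R : realType) (n : nat).
Local Notation J := (Jmx R n).
Implicit Types P W X A : 'M[R]_(n + n).

Lemma tr_Jmx : J^T = - J.
Proof.
by rewrite /Jmx tr_block_mx !trmx0 linearN/= trmx1 opp_block_mx !oppr0 opprK.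
Qed.

Lemma mul_Jmx : J *m J = - 1%:M.
Proof.
rewrite /Jmx mulmx_block !(mul0mx, mulmx0, mul1mx, mulNmx, mulmx1, add0r, addr0).
by rewrite [in RHS]scalar_mx_block opp_block_mx !oppr0.
Qed.

(* [1 - P + J P J] is a symmetric idempotent of trace [0], hence zero. *)
Lemma LG_Jmx P : LG P -> J *m P = J - P *m J.
Proof.
move=> [Ps PP trP PJP].
pose M := 1%:M - P + J *m P *m J.
have Ms : M^T = M.
  rewrite /M linearD linearB/= trmx1 Ps !trmx_mul Ps tr_Jmx.
  by rewrite !mulNmx !mulmxN opprK mulmxA.
have MM : M *m M = M.
  have PQ : P *m (J *m P *m J) = 0 by rewrite !mulmxA PJP mul0mx.
  have QP : J *m P *m J *m P = 0 by rewrite -!mulmxA [P *m _]mulmxA PJP mulmx0.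
  have QQ : J *m P *m J *m (J *m P *m J) = - (J *m P *m J).
    rewrite -!mulmxA [J *m (J *m _)]mulmxA mul_Jmx mulNmx mul1mx !mulmxN.
    by rewrite [P *m (P *m _)]mulmxA PP.
  rewrite /M !(mulmxDl, mulmxDr, mulNmx, mulmxN, mul1mx, mulmx1) PP PQ QP QQ.
  mx_abel.
have M0 : M = 0.
  apply: mxtrace_trmul_eq0; rewrite Ms MM /M mxtraceD linearB/= mxtrace1 trP.
  rewrite -mulmxA mxtrace_mulC -mulmxA mul_Jmx mulmxN mulmx1 linearN/= trP natrD.
  by ring.
have : M *m J = 0 by rewrite M0 mul0mx.
rewrite /M mulmxDl mulmxBl mul1mx -[J *m P *m J *m J]mulmxA mul_Jmx mulmxN mulmx1.
by move/eqP; rewrite subr_eq0 => /eqP ->.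
Qed.

(** The second equation linearizes [J *m P = J - P *m J], the form that [LG_Jmx] gives to the
    Lagrangian condition; the third linearizes idempotency. *)
Definition tangent_LG P W : Prop :=
  [/\ W^T = W, J *m W = - (W *m J) & W *m P + P *m W = W].

Lemma tangent_LGZ P (a : R) W : tangent_LG P W -> tangent_LG P (a *: W).
Proof.
move=> [Ws WJ WP]; split; first by rewrite linearZ/= Ws.
  by rewrite -scalemxAr WJ -scalemxAl scalerN.
by rewrite -scalemxAr -scalemxAl -scalerDr WP.
Qed.

Lemma tangent_LGD P W X : tangent_LG P W -> tangent_LG P X -> tangent_LG P (W + X).
Proof.
move=> [Ws WJ WP] [Xs XJ XP]; split; first by rewrite linearD/= Ws Xs.
  by rewrite mulmxDr WJ XJ mulmxDl opprD.
by rewrite mulmxDr mulmxDl addrACA WP XP.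
Qed.

Lemma invmx_comm (m : nat) (D X : 'M[R]_m) :
  D \in unitmx -> D *m X = X *m D -> invmx D *m X = X *m invmx D.
Proof.
by move=> uD h; rewrite -{1}[X](mulmxK uD) -h !mulmxA mulVmx// mul1mx.
Qed.

(** For tangent [W] this is the orthogonal projection onto the image of [(1 + W) P]: the Gram matrix
    [P (1 + W)^2 P] equals [P (1 + W^2)], and [1 + W^2] commutes with both [P] and [W]. *)
Definition retraction_LG P W : 'M[R]_(n + n) :=
  (1%:M + W) *m P *m (1%:M + W) *m invmx (1%:M + W *m W).

Section Retraction.
Variables (P W : 'M[R]_(n + n)).
Hypotheses (LGP : LG P) (tW : tangent_LG P W).
Let D := 1%:M + W *m W.
Let G := invmx D.
Let L := 1%:M + W.

Let Ws : W^T = W. Proof. by case: tW. Qed.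
Let Ps : P^T = P. Proof. by case: LGP. Qed.
Let PP : P *m P = P. Proof. by case: LGP. Qed.
Let WP : W *m P = W - P *m W.
Proof. by case: tW => _ _ h; rewrite -{2}h addrK. Qed.

(** With respect to the image and the kernel of [P], a tangent vector is block off-diagonal;
    accordingly its square is block diagonal and commutes with [P]. *)
Lemma tangent_LG_diag : P *m W *m P = 0.
Proof. by rewrite -mulmxA WP mulmxBr mulmxA PP subrr. Qed.

Lemma tangent_LG_sqr : W *m W *m P = P *m (W *m W).
Proof.
rewrite -mulmxA WP mulmxBr [W *m (P *m W)]mulmxA WP mulmxBl subKr.
by rewrite mulmxA.
Qed.

Lemma unitmx_tangent_LG : D \in unitmx.
Proof. by rewrite /D -{2}Ws unitmx_add1_gram. Qed.

Let GW : G *m W = W *m G.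
Proof.
apply: invmx_comm; first exact: unitmx_tangent_LG.
by rewrite /D mulmxDl mulmxDr mul1mx mulmx1 mulmxA.
Qed.

Lemma inv_tangent_LG_comm : G *m P = P *m G.
Proof.
apply: invmx_comm; first exact: unitmx_tangent_LG.
by rewrite /D mulmxDl mulmxDr mul1mx mulmx1 tangent_LG_sqr.
Qed.
Let GP := inv_tangent_LG_comm.

Let GJ : G *m J = J *m G.
Proof.
apply: invmx_comm; first exact: unitmx_tangent_LG.
have [_ h _] := tW.
rewrite /D mulmxDl mulmxDr mul1mx mulmx1; congr (_ + _).
by rewrite mulmxA h mulNmx -[W *m J *m W]mulmxA h mulmxN opprK mulmxA.
Qed.

Let DG : D *m G = 1%:M.
Proof. by rewrite /G mulmxV// unitmx_tangent_LG. Qed.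

Let GL : G *m L = L *m G.
Proof. by rewrite /L mulmxDl mulmxDr mul1mx mulmx1 GW. Qed.

Let N := L *m P *m L.
Let GN : G *m N = N *m G.
Proof.
by rewrite /N !mulmxA GL -[L *m G *m P]mulmxA GP !mulmxA -[L *m P *m G *m L]mulmxA GL !mulmxA.
Qed.

Let LL : L *m L = D + (W + W).
Proof. rewrite /L /D mulmxDl mul1mx mulmxDr mulmx1; mx_abel. Qed.

(** The cross term [W + W] of [L *m L] disappears between two copies of [P] by [tangent_LG_diag]. *)
Let PLLP : P *m (L *m L) *m P = P *m D.
Proof.
rewrite LL (mulmxDr P D) (mulmxDl (P *m D)) (mulmxDr P W W) (mulmxDl (P *m W)).
rewrite tangent_LG_diag !addr0.
by rewrite /D mulmxDr mulmx1 mulmxDl PP -mulmxA tangent_LG_sqr mulmxA PP.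
Qed.

Let Gs : G^T = G.
Proof. by rewrite /G trmx_inv /D linearD/= trmx1 trmx_mul Ws. Qed.

Let Ns : N^T = N.
Proof. by rewrite /N !trmx_mul Ps /L linearD/= trmx1 Ws mulmxA. Qed.

(** Both [A] and [G] commute with [P] while [W] is block off-diagonal, so the product is block
    off-diagonal and traceless. *)
Lemma mxtrace_tangent_LG A : A *m P = P *m A -> \tr (A *m W *m G) = 0.
Proof.
move=> AP; have [_ _ WE] := tW.
have half : \tr (A *m (P *m W) *m G) = 0.
  rewrite -PP -!mulmxA [A *m _]mulmxA AP -mulmxA mxtrace_mulC.
  by rewrite -!mulmxA GP [P *m (W *m _)]mulmxA [P *m W *m _]mulmxA
             tangent_LG_diag mul0mx mulmx0 mxtrace0.
have half' : \tr (A *m (W *m P) *m G) = 0.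
  rewrite -PP -!mulmxA -GP !mulmxA mxtrace_mulC !mulmxA -AP.
  by rewrite -!(mulmxA A) tangent_LG_diag !(mulmx0, mul0mx) mxtrace0.
by rewrite -WE mulmxDr mulmxDl mxtraceD half half' addr0.
Qed.

(** Idempotency comes from [N N = N D], and the trace from [tr (L L P G) = tr P + 2 tr (W P G)],
    whose last term vanishes. For the Lagrangian condition, [J] anticommutes with [W], so
    [L J L = J (1 - W^2)]; the last factor commutes with [P], which leaves [P J P = 0]. *)
Lemma retraction_LG_in : LG (retraction_LG P W).
Proof.
rewrite /retraction_LG -/L -/D -/G -/N; split.
- by rewrite trmx_mul Gs Ns GN.
- rewrite mulmxA -[N *m G *m N]mulmxA GN mulmxA -[_ *m G *m G]mulmxA.
  have -> : N *m N = N *m D.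
    rewrite /N; have -> : L *m P *m L *m (L *m P *m L) =
      L *m (P *m (L *m L) *m P) *m L by rewrite !mulmxA.
    rewrite PLLP -!mulmxA; congr (_ *m (_ *m _)).
    by rewrite /L /D !(mulmxDl, mulmxDr, mul1mx, mulmx1) !mulmxA; mx_abel.
  by rewrite mulmxA -[N *m D *m G]mulmxA DG mulmx1.
- rewrite /N -mulmxA -GL mulmxA mxtrace_mulC !mulmxA -[L *m L *m P *m G]mulmxA.
  rewrite -GP mulmxA mxtrace_mulC LL (mulmxDl D) DG mulmxDr mulmx1 mxtraceD.
  rewrite (mulmxDl W) mulmxDr mxtraceD mulmxA mxtrace_tangent_LG// !addr0.
  by case: LGP.
- have -> : N *m G *m J *m (N *m G) = N *m J *m N *m G *m G.
    rewrite -(mulmxA N G) GJ (mulmxA N J G) (mulmxA _ N G).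
    by rewrite -(mulmxA (N *m J) G N) GN (mulmxA (N *m J)).
  suff -> : N *m J *m N = 0 by rewrite !mul0mx.
  have [_ h _] := tW; have [_ _ _ PJP] := LGP.
  have LJL : L *m J *m L = J *m (1%:M - W *m W).
    have h' : W *m J = - (J *m W) by rewrite h opprK.
    rewrite /L !(mulmxDl, mulmxDr, mul1mx, mulmx1) h' mulNmx mulmxN mulmxA.
    mx_abel.
  have -> : N *m J *m N = L *m P *m (L *m J *m L) *m P *m L by rewrite /N !mulmxA.
  rewrite LJL -[L *m P *m _ *m P]mulmxA -[J *m _ *m P]mulmxA.
  have -> : (1%:M - W *m W) *m P = P *m (1%:M - W *m W).
    by rewrite mulmxBl mulmxBr mul1mx mulmx1 tangent_LG_sqr.
  by rewrite !mulmxA -[L *m P *m J]mulmxA -[L *m (P *m J) *m P]mulmxA PJP mulmx0 !mul0mx.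
Qed.

(** Separates the terms of order 0, 1 and 2 in [W] up to the factor [G], so that derivatives along
    [t *: W] at 0 can be read off. *)
Lemma retraction_LGE :
  retraction_LG P W = P + W *m G - (P + P - 1%:M) *m (W *m W) *m G.
Proof.
rewrite /retraction_LG -/L -/D -/G -/N.
have -> : N = P *m D + W - (P + P - 1%:M) *m (W *m W).
  have WPW : W *m P *m W = W *m W - P *m (W *m W).
    by rewrite WP mulmxBl mulmxA.
  rewrite /N /L /D !(mulmxDl, mulmxDr, mul1mx, mulmx1, mulNmx) WPW WP.
  rewrite !mulmxA; mx_abel.
by rewrite mulmxBl mulmxDl -[P *m D *m G]mulmxA DG mulmx1.
Qed.

End Retraction.

(** * The retraction curve with a given velocity *)

Section RetractionCurve.
Variables (P X : 'M[R]_(n + n)).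
Hypotheses (LGP : LG P) (tX : tangent_LG P X).
Let g (t : R) := retraction_LG P (t *: X).
Let D (t : R) := 1%:M + (t *: X) *m (t *: X).
Let G (t : R) := invmx (D t).
(** The polynomial matrix whose value at [t] is [D t]. By the adjugate formula the entries of [G t]
    are polynomials divided by its determinant [q], which has no real zero because every [D t] is
    invertible. *)
Let Dp : 'M[{poly R}]_(n + n) := 1%:M + 'X^2 *: map_mx polyC (X *m X).
Let q := \det Dp.

Let uD t : D t \in unitmx.
Proof. exact: unitmx_tangent_LG (tangent_LGZ t tX). Qed.

Let map_Dp t : map_mx (horner_eval t) Dp = D t.
Proof.
rewrite /Dp map_mxD map_mx1 /D -scalemxAl -scalemxAr scalerA -expr2; congr (_ + _).
move: (X *m X) => Y; apply/matrixP => i j.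
by rewrite !mxE /= horner_evalE hornerM hornerXn hornerC.
Qed.

Let qE t : q.[t] = \det (D t).
Proof. by rewrite -map_Dp det_map_mx. Qed.

Let q0 t : q.[t] != 0.
Proof. by rewrite qE -unitfE -unitmxE uD. Qed.

Let GE t : G t = q.[t]^-1 *: map_mx (horner_eval t) (\adj Dp).
Proof. by rewrite /G /invmx uD qE map_mx_adj map_Dp. Qed.

Let ratG (C : 'M[R]_(n + n)) i j : ratfun q (fun t => (C *m G t) i j).
Proof.
under eq_fun do rewrite mxE.
apply: ratfun_sum => // k; apply: ratfunM; first exact: ratfun_cst.
under eq_fun do rewrite GE !mxE.
by apply: ratfunM; [exact: ratfunV|exact: ratfun_horner].
Qed.

Let gE t : g t = P + t *: (X *m G t) -
  t ^+ 2 *: ((P + P - 1%:M) *m (X *m X) *m G t).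
Proof.
rewrite /g (retraction_LGE (tangent_LGZ t tX)) -/(D t) -/(G t).
by rewrite -!scalemxAl -!scalemxAr scalerA -!scalemxAl expr2.
Qed.

Let gijE t i j : g t i j = P i j + t * (X *m G t) i j +
  - t ^+ 2 * ((P + P - 1%:M) *m (X *m X) *m G t) i j.
Proof.
rewrite gE; move: (X *m G t) (_ *m G t) => U V.
by rewrite !mxE mulNr.
Qed.

Lemma retraction_LG_curve : curve_through (@LG R n) P g.
Proof.
split=> [|t|].
- apply: (ratfun_smooth_curve q0) => i j.
  under eq_fun do rewrite gijE.
  apply: ratfunD => //; last first.
    apply: ratfunM => //.
    have := ratfun_horner q (- 'X^2).
    by under eq_fun do rewrite hornerN hornerXn.
  apply: ratfunD => //; first exact: ratfun_cst.
  by apply: ratfunM; [exact: ratfun_id|exact: ratG].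
- exact/retraction_LG_in/tangent_LGZ.
- by rewrite gE expr2 !(scale0r, mulr0, subr0, addr0).
Qed.

Let G0 : G 0 = 1%:M.
Proof. by rewrite /G /D !scale0r mul0mx addr0 invmx1. Qed.

Lemma is_derive_retraction_LG : is_derive (0 : R) (1 : R) g X.
Proof.
apply/is_derive_mxP => i j.
pose h t := (X *m G t) i j - t * ((P + P - 1%:M) *m (X *m X) *m G t) i j.
have -> : (fun t => g t i j) = (fun t => P i j + t * h t).
  by apply/funext => t; rewrite gijE /h; ring.
have -> : X i j = h 0 by rewrite /h mul0r subr0 G0 mulmx1.
apply: is_derive_at0.
have [hd _] := ratfun_derive q0 (ratG X i j).
have [hd' _] := ratfun_derive q0 (ratG ((P + P - 1%:M) *m (X *m X)) i j).
by apply: derivableB => //; apply: derivableM.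
Qed.

(** When [A] commutes with [P], [mxtrace_tangent_LG] removes the linear term, so the function along
    the curve is a constant plus [t ^+ 2 * h t] with [h] rational. *)
Lemma is_derive2_rayleigh_retraction A : A *m P = P *m A ->
  is_derive (0 : R) (1 : R) ((rayleigh A \o g)^`())
    (- 2 * \tr (A *m (P + P - 1%:M) *m (X *m X))).
Proof.
move=> AP.
pose C := - (A *m (P + P - 1%:M) *m (X *m X)).
pose h t := \tr (C *m G t).
have -> : rayleigh A \o g = (fun t => \tr (A *m P) + t ^+ 2 * h t).
  apply/funext => t; rewrite /= /rayleigh gE mulmxBr mulmxDr linearB/= mxtraceD.
  rewrite (scalemxAl t X) (mulmxA A).
  rewrite (mxtrace_tangent_LG LGP (tangent_LGZ t tX) AP) addr0.
  by rewrite -scalemxAr mxtraceZ /h /C mulNmx linearN/= mulrN !mulmxA.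
have -> : - 2 * \tr (A *m (P + P - 1%:M) *m (X *m X)) = 2 * h 0.
  by rewrite /h G0 mulmx1 /C linearN/=; ring.
apply: (is_derive2_at0 _ q0).
by apply: ratfun_sum => // i; exact: ratG.
Qed.

End RetractionCurve.

(** * The two descriptions of the tangent space agree *)

Lemma tangent_LG_tangent P X :
  LG P -> tangent_LG P X -> tangent (@LG R n) P X.
Proof.
move=> LGP tX; exists (fun t => retraction_LG P (t *: X)).
  exact: retraction_LG_curve.
by rewrite derive1E; have [] := is_derive_retraction_LG tX.
Qed.

(** Differentiate the identities [g^T = g], [J g = J - g J] and [g g = g], valid all along the
    curve. *)
Lemma tangent_tangent_LG P X : tangent (@LG R n) P X -> tangent_LG P X.
Proof.
move=> [g [gs gLG g0] gX].
have gd : is_derive (0 : R) (1 : R) g X by rewrite -gX; apply: is_derive1; exact: (gs 0%N).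
split.
- have := is_derive_trmx gd.
  have -> : (fun t => (g t)^T) = g by apply/funext => t; case: (gLG t).
  by move/is_derive_unique; apply.
- have := is_derive_mulmx (is_derive_cst J (0 : R) (1 : R)) gd.
  have := is_derive_mulmx gd (is_derive_cst J (0 : R) (1 : R)).
  rewrite mulmx0 mul0mx addr0 add0r => d1 d2.
  have d3 : is_derive (0 : R) (1 : R) (fun t => J - g t *m J) (0 - X *m J).
    exact: is_deriveB (is_derive_cst J (0 : R) (1 : R)) d1.
  rewrite -sub0r; apply: is_derive_unique d3.
  suff <- : (fun t => cst J t *m g t) = (fun t => J - g t *m J) by [].
  by apply/funext => t; rewrite /cst LG_Jmx.
- have := is_derive_mulmx gd gd; rewrite g0.
  have -> : (fun t => g t *m g t) = g by apply/funext => t; case: (gLG t).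
  by move/is_derive_unique; apply.
Qed.

(** * Critical points and the Hessian of the Rayleigh quotient *)

Lemma symmetric_hamiltonian_tr A : symmetric_hamiltonian A -> A^T = A.
Proof.
by move=> [S [T [Ss Ts ->]]]; rewrite tr_block_mx linearN/= Ss Ts.
Qed.

Lemma symmetric_hamiltonian_Jmx A :
  symmetric_hamiltonian A -> J *m A = - (A *m J).
Proof.
move=> [S [T [_ _ ->]]]; rewrite /Jmx !mulmx_block.
rewrite !(mul0mx, mulmx0, mul1mx, mulNmx, mulmx1, mulmxN, add0r, addr0, opprK).
by rewrite opp_block_mx !opprK.
Qed.

(* The test vector is [Y + Y^T] with [Y = P A (1 - P)]: the derivative of
   [tr (A _)] along it is [2 tr (Y^T Y)]. *)
Lemma critical_point_comm A P : symmetric_hamiltonian A ->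
  critical_point (@LG R n) (rayleigh A) P -> A *m P = P *m A.
Proof.
move=> hA [LGP crit].
have As := symmetric_hamiltonian_tr hA; have AJ := symmetric_hamiltonian_Jmx hA.
have [Ps PP _ _] := LGP; have JP := LG_Jmx LGP.
have [Q QE] : exists Q, Q = 1%:M - P by exists (1%:M - P).
have Qs : Q^T = Q by rewrite QE linearB/= trmx1 Ps.
have QP : Q *m P = 0 by rewrite QE mulmxBl mul1mx PP subrr.
have PQ : P *m Q = 0 by rewrite QE mulmxBr mulmx1 PP subrr.
have QQ : Q *m Q = Q by rewrite {2}QE mulmxBr mulmx1 QP subr0.
have JQ : J *m Q = P *m J by rewrite QE mulmxBr mulmx1 JP subKr.
have JP1 : J *m P = Q *m J by rewrite JP QE mulmxBl mul1mx.
pose Y := P *m A *m Q.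
have YT : Y^T = Q *m A *m P by rewrite /Y !trmx_mul Qs Ps As mulmxA.
have tX : tangent_LG P (Y + Y^T).
  split; first by rewrite linearD/= trmxK addrC.
    have E1 : J *m Y = - (Y^T *m J).
      rewrite YT /Y !mulmxA JP1 -(mulmxA Q J A) AJ mulmxN mulNmx mulmxA.
      by rewrite -(mulmxA (Q *m A) J Q) JQ mulmxA.
    have E2 : J *m Y^T = - (Y *m J).
      rewrite YT /Y !mulmxA JQ -(mulmxA P J A) AJ mulmxN mulNmx mulmxA.
      by rewrite -(mulmxA (P *m A) J P) JP1 mulmxA.
    by rewrite mulmxDr mulmxDl opprD E1 E2 addrC.
  rewrite YT /Y mulmxDl mulmxDr -(mulmxA _ Q P) QP mulmx0 add0r -(mulmxA _ P P) PP.
  by rewrite !mulmxA PP PQ !mul0mx addr0 addrC.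
have Y0 : Y = 0.
  have d1 := is_derive_mxtrace (is_derive_mulmx (is_derive_cst A (0 : R) (1 : R))
     (is_derive_retraction_LG tX)).
  have d2 := crit _ (retraction_LG_curve LGP tX).
  have := is_derive_unique d1 d2; rewrite mul0mx add0r /cst mulmxDr mxtraceD.
  have -> : \tr (A *m Y^T) = \tr (A *m Y).
    by rewrite -mxtrace_tr trmx_mul trmxK As mxtrace_mulC.
  have -> : \tr (A *m Y) = \tr (Y^T *m Y).
    rewrite YT /Y -{1}QQ !mulmxA mxtrace_mulC !mulmxA.
    by rewrite -(mulmxA _ P P) PP.
  move=> h; apply: mxtrace_trmul_eq0; lra.
(* Since [Y = 0] reads [P A = P A P] and the right-hand side is symmetric, [P A] equals its
   transpose [A P]. *)
have PA : P *m A = P *m A *m P.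
  by apply/eqP; rewrite -subr_eq0 -{1}[P *m A]mulmx1 -mulmxBr -QE -/Y Y0.
have := congr1 trmx PA.
by rewrite !trmx_mul Ps As mulmxA -PA.
Qed.

(** Retraction curves determine the Hessian on the diagonal, and polarization determines it on all
    pairs. If [S X + X S = 0], then [X] is orthogonal to every tangent vector for the Hessian, and
    nondegeneracy applies. *)
Lemma nondegenerate_injective A P X : symmetric_hamiltonian A ->
  nondegenerate_critical_point (@LG R n) (rayleigh A) P ->
  tangent_LG P X ->
  (P *m A + A *m P - A) *m X + X *m (P *m A + A *m P - A) = 0 -> X = 0.
Proof.
move=> hA [crit [H [Hs Hl Hd] nd]] tX.
have LGP : LG P by case: crit.
have AP := critical_point_comm hA crit.
set S := P *m A + A *m P - A => SX.
have SE : A *m (P + P - 1%:M) = S.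
  by rewrite mulmxBr mulmxDr mulmx1 {1}AP.
have HE Y : tangent_LG P Y -> H Y Y = - 2 * \tr (S *m (Y *m Y)).
  move=> tY; have c := retraction_LG_curve LGP tY.
  have := Hd _ c; rewrite derive1E.
  have [_ ->] := is_derive_retraction_LG tY => d1.
  have := is_derive2_rayleigh_retraction LGP tY AP; rewrite SE => d2.
  exact: is_derive_unique d1 d2.
apply: nd; first exact: tangent_LG_tangent.
move=> Y tY'; have tY := tangent_tangent_LG tY'.
have tX' := tangent_LG_tangent LGP tX.
have tXY := tangent_LGD tX tY.
have tXY' := tangent_LG_tangent LGP tXY.
have L1 U V W' : tangent (@LG R n) P U -> tangent (@LG R n) P V ->
   tangent (@LG R n) P W' -> H (U + V) W' = H U W' + H V W'.
  by move=> tU tV tW; rewrite -{1}[U]scale1r Hl// mul1r.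
(* Linearity of [H] is given in the first argument, so symmetry is used to expand the second one. *)
have := HE _ tXY; rewrite L1// (Hs X (X + Y))// (Hs Y (X + Y))// !L1//.
rewrite (Hs Y X)// (HE _ tX) (HE _ tY).
clearbody S.
rewrite !mulmxDl !mulmxDr !mxtraceD.
have : \tr (S *m (X *m Y)) + \tr (S *m (Y *m X)) = 0.
  rewrite -(mxtrace0 R (n + n)) -(mul0mx _ Y) -SX mulmxDl mxtraceD !mulmxA.
  by congr (_ + _); rewrite mxtrace_mulC mulmxA.
move=> h0 h1; lra.
Qed.

End LagrangeGrassmannian.

(** * The algorithm in orthosymplectic frames *)

Section NewtonStep.
Variables (R : realType) (n : nat).
Local Notation J := (Jmx R n).
Local Notation N := ((n + n)%:R : R).
Local Notation E := (block_mx (1%:M : 'M[R]_n) 0 0 (0 : 'M[R]_n)).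
Implicit Types (T M B P A : 'M[R]_(n + n)) (W Z U V a b s t : 'M[R]_n).

(** For orthogonal [T], commuting with [J] is equivalent to [T^T J T = J]; this form lets [J] pass
    through conjugations by [T]. *)
Definition orthosymplectic T : Prop := T^T *m T = 1%:M /\ J *m T = T *m J.

Lemma OSp_orthosymplectic T : OSp T -> orthosymplectic T.
Proof.
move=> [TT _ TJT]; split=> //.
by rewrite -{2}TJT !mulmxA (mulmx1C TT) mul1mx.
Qed.

Section Orthosymplectic.
Variable T : 'M[R]_(n + n).
Hypothesis oT : orthosymplectic T.

Lemma orthosymplectic_mulVT : T^T *m T = 1%:M.
Proof. by case: oT. Qed.

Lemma orthosymplectic_mulTV : T *m T^T = 1%:M.
Proof. exact: mulmx1C orthosymplectic_mulVT. Qed.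

Lemma orthosymplectic_Jmx_tr : J *m T^T = T^T *m J.
Proof.
have [_ h] := oT; have := congr1 trmx h.
by rewrite !trmx_mul tr_Jmx mulmxN mulNmx => /oppr_inj.
Qed.

Lemma orthosymplectic_norm : `|T| <= 1.
Proof. exact/mx_norm_orthogonal/orthosymplectic_mulVT. Qed.

Lemma orthosymplectic_norm_tr : `|T^T| <= 1.
Proof. by rewrite mx_norm_tr orthosymplectic_norm. Qed.

(** The entrywise norm is not invariant under orthogonal conjugation; each of the two products costs
    a factor [N]. *)
Lemma conj_norm M : `|T *m M *m T^T| <= N ^+ 2 * `|M|.
Proof.
apply: (le_trans (mx_norm_mul1r_le _ orthosymplectic_norm_tr)).
by rewrite expr2 -mulrA ler_wpM2l// mx_norm_mul1l_le// orthosymplectic_norm.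
Qed.

Lemma conj_tr_norm M : `|T^T *m M *m T| <= N ^+ 2 * `|M|.
Proof.
apply: (le_trans (mx_norm_mul1r_le _ orthosymplectic_norm)).
by rewrite expr2 -mulrA ler_wpM2l// mx_norm_mul1l_le// orthosymplectic_norm_tr.
Qed.

Lemma conj_trK M : T *m (T^T *m M *m T) *m T^T = M.
Proof.
by rewrite !mulmxA orthosymplectic_mulTV mul1mx -mulmxA orthosymplectic_mulTV mulmx1.
Qed.

Lemma conjK M : T^T *m (T *m M *m T^T) *m T = M.
Proof.
by rewrite !mulmxA orthosymplectic_mulVT mul1mx -mulmxA orthosymplectic_mulVT mulmx1.
Qed.

Lemma conj_mul M M' :
  (T *m M *m T^T) *m (T *m M' *m T^T) = T *m (M *m M') *m T^T.
Proof. by rewrite !mulmxA -(mulmxA _ T^T T) orthosymplectic_mulVT mulmx1. Qed.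

Lemma conj_tr_mul M M' :
  (T^T *m M *m T) *m (T^T *m M' *m T) = T^T *m (M *m M') *m T.
Proof. by rewrite !mulmxA -(mulmxA _ T T^T) orthosymplectic_mulTV mulmx1. Qed.

Lemma conj_Jmx M : J *m (T *m M *m T^T) = T *m (J *m M) *m T^T.
Proof. by have [_ h] := oT; rewrite !mulmxA h. Qed.

Lemma conj_mulJmx M : T *m M *m T^T *m J = T *m (M *m J) *m T^T.
Proof. by rewrite !mulmxA -(mulmxA _ T^T J) -orthosymplectic_Jmx_tr !mulmxA. Qed.

Lemma conj_tr_Jmx M : J *m (T^T *m M *m T) = T^T *m (J *m M) *m T.
Proof. by rewrite !mulmxA orthosymplectic_Jmx_tr. Qed.

Lemma conj_tr_mulJmx M : T^T *m M *m T *m J = T^T *m (M *m J) *m T.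
Proof. by have [_ h] := oT; rewrite !mulmxA -(mulmxA _ T J) -h !mulmxA. Qed.

End Orthosymplectic.

(** * Block forms and the Lyapunov operator in a frame *)

Lemma mul_Jmx_block (a b c d : 'M[R]_n) :
  J *m block_mx a b c d = block_mx c d (- a) (- b).
Proof.
by rewrite /Jmx mulmx_block !(mul0mx, mul1mx, mulNmx, add0r, addr0).
Qed.

Lemma mul_block_Jmx (a b c d : 'M[R]_n) :
  block_mx a b c d *m J = block_mx (- b) a (- d) c.
Proof.
by rewrite /Jmx mulmx_block !(mulmx0, mulmx1, mulmxN, add0r, addr0).
Qed.

Lemma hamiltonian_blocks B : B^T = B -> J *m B = - (B *m J) ->
  exists s t, [/\ s^T = s, t^T = t & B = block_mx s t t (- s)].
Proof.
rewrite -[B]submxK tr_block_mx mul_Jmx_block mul_block_Jmx opp_block_mx !opprK.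
move=> /eq_block_mx[ss _ ts _] /eq_block_mx[tE sE _ _].
exists (ulsubmx B), (ursubmx B); split=> //; first by rewrite ts tE.
by rewrite tE sE.
Qed.

Lemma lagrangian_blocks P : J *m P = J - P *m J ->
  exists a b, P = block_mx a b b (1%:M - a).
Proof.
rewrite -[P]submxK mul_Jmx_block mul_block_Jmx /Jmx opp_block_mx add_block_mx.
rewrite !opprK add0r => /eq_block_mx[bE dE _ _].
by exists (ulsubmx P), (ursubmx P); rewrite bE dE.
Qed.

(* The linear conditions defining the tangent space and the Lyapunov operator are
   stacked into one injective linear map, which is therefore bounded below. *)
Lemma lyapunov_coercive A P : LG P ->
  (forall X, tangent_LG P X ->
    (P *m A + A *m P - A) *m X + X *m (P *m A + A *m P - A) = 0 -> X = 0) ->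
  exists2 c : R, 0 <= c & forall X, X^T = X -> J *m X = - (X *m J) ->
    `|X| <= c * (`|X *m P + P *m X - X| +
      `|(P *m A + A *m P - A) *m X + X *m (P *m A + A *m P - A)|).
Proof.
move=> LGP inj; set S := P *m A + A *m P - A in inj *; clearbody S.
pose f X := block_mx (X - X^T) (J *m X + X *m J) (X *m P + P *m X - X) (S *m X + X *m S).
have flin : linear f.
  move=> k X Y; rewrite /f scale_block_mx add_block_mx; congr block_mx.
  - by rewrite linearP/= scalerBr opprD addrACA.
  - by rewrite mulmxDl mulmxDr -scalemxAl -scalemxAr scalerDr addrACA.
  - by rewrite mulmxDl mulmxDr -scalemxAl -scalemxAr scalerBr scalerDr
               opprD !addrA; mx_abel.
  - by rewrite mulmxDl mulmxDr -scalemxAl -scalemxAr scalerDr addrACA.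
have finj X : f X = 0 -> X = 0.
  rewrite /f => h; have {h} := etrans h (esym (block_mx0 _ _ _ _ _)) => /eq_block_mx[h1 h2 h3 h4].
  apply: inj h4; split.
  - by apply/esym/eqP; rewrite -subr_eq0 h1.
  - by apply/eqP; rewrite -subr_eq0 opprK h2.
  - by apply/eqP; rewrite -subr_eq0 h3.
have [c c0 cb] := linear_inj_bounded_below flin finj.
exists c => // X Xs XJ; apply: (le_trans (cb X)); rewrite ler_wpM2l//.
apply: mx_norm_block; rewrite ?addr_ge0//.
- by rewrite Xs subrr normr0 addr_ge0.
- by rewrite XJ addNr normr0 addr_ge0.
- by rewrite lerDl.
- by rewrite lerDr.
Qed.

(** The bound at [P] is applied to [X = T^T [0 W; W 0] T], which is tangent at [proj_of T] rather
    than at [P]. The resulting errors are proportional to the distance of the two projections and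
    are absorbed into the left-hand side. *)
Lemma lyapunov_coercive_near A P : LG P -> A^T = A -> J *m A = - (A *m J) ->
  (forall X, tangent_LG P X ->
    (P *m A + A *m P - A) *m X + X *m (P *m A + A *m P - A) = 0 -> X = 0) ->
  exists K delta : R, [/\ 0 <= K, 0 < delta & forall T, orthosymplectic T ->
    `|proj_of T - P| <= delta -> forall W, W^T = W ->
    `|W| <= K * `|ulsubmx (T *m A *m T^T) *m W + W *m ulsubmx (T *m A *m T^T)|].
Proof.
move=> LGP As AJ inj; have [c c0 cb] := lyapunov_coercive LGP inj.
(* The coefficient of the total perturbation error, collected from [e1] and [e2] below. *)
pose k := c * (2 * N + 4 * N ^+ 2 * `|A|).
have k0 : 0 <= k by rewrite mulr_ge0// addr_ge0// !mulr_ge0// exprn_ge0.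
(* This radius gives [k * delta <= 1/2], and absorbing half of the norm of [X] produces the factor
   2. The power [N ^+ 4] comes from two conjugations, one bounding the Lyapunov term and one
   returning from [X] to [W]. *)
exists (2 * c * N ^+ 4), (2 * (k + 1))^-1.
split=> [||T oT pP W Ws]; first by rewrite !mulr_ge0// exprn_ge0.
  by rewrite invr_gt0 mulr_gt0// ltr_wpDl.
set delta := _^-1 in pP.
have [s [t [ss ts BE]]] : exists s t, [/\ s^T = s, t^T = t &
    T *m A *m T^T = block_mx s t t (- s)].
  apply: hamiltonian_blocks; first by rewrite !trmx_mul trmxK As mulmxA.
  by rewrite conj_Jmx// conj_mulJmx// AJ mulmxN mulNmx.
rewrite BE block_mxKul; set LW := s *m W + W *m s.
pose O := block_mx 0 W W 0.
pose X := T^T *m O *m T.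
have Xs : X^T = X by rewrite /X !trmx_mul trmxK mulmxA /O tr_block_mx !trmx0 Ws.
have XJ : J *m X = - (X *m J).
  rewrite /X conj_tr_Jmx// conj_tr_mulJmx// /O mul_Jmx_block mul_block_Jmx.
  by rewrite -mulNmx -mulmxN opp_block_mx !oppr0 opprK.
have cX := cb X Xs XJ.
set p := proj_of T in pP.
have pX : X *m p + p *m X = X.
  rewrite /X /p /proj_of !conj_tr_mul// -mulmxDl -mulmxDr; congr (_ *m _ *m _).
  rewrite /O !mulmx_block add_block_mx.
  by rewrite !(mul0mx, mulmx0, mul1mx, mulmx1, add0r, addr0).
have SX : (p *m A + A *m p - A) *m X + X *m (p *m A + A *m p - A) =
          T^T *m block_mx 0 LW LW 0 *m T.
  (* In the frame of [T], the projection [p] is [diag (1, 0)], so only the diagonal blocks survive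
     and the lower one changes sign. *)
  have -> : p *m A + A *m p - A = T^T *m block_mx s 0 0 s *m T.
    rewrite -(conjK oT A) BE /p /proj_of !conj_tr_mul// -mulmxDl -mulmxDr.
    rewrite -mulmxBl -mulmxBr; congr (_ *m _ *m _).
    rewrite !mulmx_block add_block_mx opp_block_mx add_block_mx.
    rewrite !(mul0mx, mulmx0, mul1mx, mulmx1, add0r, addr0, subrr, opprK).
    by rewrite addrK.
  rewrite /X !conj_tr_mul// -mulmxDl -mulmxDr; congr (_ *m _ *m _).
  rewrite /O !mulmx_block add_block_mx.
  by rewrite !(mul0mx, mulmx0, mul1mx, mulmx1, add0r, addr0).
pose d := P - p.
have dd : `|d| <= delta by rewrite /d distrC.
have d0 : 0 <= delta by exact: le_trans dd.
have e1 : `|X *m P + P *m X - X| <= 2 * N * delta * `|X|.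
  have -> : X *m P + P *m X - X = X *m d + d *m X.
    rewrite -[in X in _ - X]pX /d mulmxBl mulmxBr; mx_abel.
  apply: (le_trans (ler_normD _ _)).
  have h1 := mx_norm_mul_le (lexx `|X|) dd.
  have h2 := mx_norm_mul_le dd (lexx `|X|).
  apply: (le_trans (lerD h1 h2)); lra.
have e2 : `|(P *m A + A *m P - A) *m X + X *m (P *m A + A *m P - A)| <=
   N ^+ 2 * `|LW| + 4 * N ^+ 2 * `|A| * delta * `|X|.
  have -> : (P *m A + A *m P - A) *m X + X *m (P *m A + A *m P - A) =
     ((p *m A + A *m p - A) *m X + X *m (p *m A + A *m p - A)) +
     ((d *m A + A *m d) *m X + X *m (d *m A + A *m d)).
    rewrite /d !(mulmxDl, mulmxDr, mulNmx, mulmxN) !mulmxA; mx_abel.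
  apply: (le_trans (ler_normD _ _)); apply: lerD.
    rewrite SX; apply: (le_trans (conj_tr_norm oT _)).
    rewrite ler_wpM2l ?exprn_ge0//.
    by apply: mx_norm_block => //; rewrite normr0.
  have h : `|d *m A + A *m d| <= 2 * N * `|A| * delta.
    apply: (le_trans (ler_normD _ _)).
    apply: (le_trans (lerD (mx_norm_mul_le dd (lexx `|A|)) (mx_norm_mul_le (lexx `|A|) dd))).
    lra.
  apply: (le_trans (ler_normD _ _)).
  apply: (le_trans (lerD (mx_norm_mul_le h (lexx `|X|)) (mx_norm_mul_le (lexx `|X|) h))).
  lra.
have kd : k * delta <= 2^-1.
  rewrite /delta invfM mulrCA -[leRHS]mulr1 ler_wpM2l// ?invr_ge0//.
  by rewrite ler_pdivrMr ?ltr_wpDl// mul1r lerDl.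
have e3 : `|X| <= 2 * c * N ^+ 2 * `|LW|.
  have h1 := ler_wpM2l c0 (lerD e1 e2).
  have h2 := ler_wpM2r (normr_ge0 X) kd.
  have h3 : c * (2 * N * delta * `|X| +
      (N ^+ 2 * `|LW| + 4 * N ^+ 2 * `|A| * delta * `|X|)) =
      c * N ^+ 2 * `|LW| + k * delta * `|X| by rewrite /k; ring.
  rewrite h3 in h1; have h4 := le_trans cX h1.
  rewrite -!mulrA; rewrite -!mulrA in h2 h4; lra.
have e4 : `|W| <= `|O|.
  by rewrite -[W](block_mxKur (0 : 'M[R]_n) W W 0) mx_norm_ursubmx.
apply: (le_trans e4); rewrite -(conj_trK oT O).
apply: (le_trans (conj_norm oT _)).
apply: (le_trans (ler_wpM2l (exprn_ge0 2 (ler0n R (n + n))) e3)).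
lra.
Qed.

(* Adding the skew part of [M] makes the Lyapunov operator injective on all
   matrices, hence surjective. *)
Lemma lyapunov_exists s t : s^T = s -> t^T = t ->
  (forall W, W^T = W -> s *m W + W *m s = 0 -> W = 0) ->
  exists Z, Z^T = Z /\ s *m Z + Z *m s = - t.
Proof.
move=> ss ts inj.
pose f (M : 'M[R]_n) := s *m (M + M^T) + (M + M^T) *m s + (M - M^T).
have symD (M : 'M[R]_n) : (M + M^T)^T = M + M^T by rewrite linearD/= trmxK addrC.
have Lsym W : W^T = W -> (s *m W + W *m s)^T = s *m W + W *m s.
  by move=> Ws; rewrite linearD/= !trmx_mul ss Ws addrC.
(* The part [M + M^T] contributes a symmetric matrix, so a symmetric value of [f] forces the skew
   part [M - M^T] to be symmetric, hence zero. *)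
have asym (M : 'M[R]_n) : (f M)^T = f M -> M^T = M.
  rewrite /f linearD/= (Lsym _ (symD M)) => /addrI.
  rewrite linearB/= trmxK => /matrixP h; apply/matrixP => i j.
  by have := h i j; rewrite !mxE; lra.
have flin : linear f.
  move=> k X Y; rewrite /f linearP/=; set X' := X^T; set Y' := Y^T.
  rewrite !(mulmxDl, mulmxDr) -!(scalemxAl, scalemxAr).
  by rewrite !(scalerDr, scalerN); mx_abel.
have finj (M : 'M[R]_n) : f M = 0 -> M = 0.
  move=> h; have Ms : M^T = M by apply: asym; rewrite h trmx0.
  have M2 : M + M^T = 0.
    by apply: inj; [exact: symD|move: h; rewrite /f {3}Ms subrr addr0].
  apply/matrixP => i j; have /matrixP/(_ i j) := M2; rewrite Ms !mxE; lra.
have [M fM] := linear_inj_surj flin finj (- t).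
have Ms : M^T = M by apply: asym; rewrite fM linearN/= ts.
by exists (M + M^T); split; [exact: symD|move: fM; rewrite /f {3}Ms subrr addr0].
Qed.

(** Here [e] bounds the first-order distance from the target [[a b; b 1-a]] to [diag (1, 0)]. The
    constant depends on [K], [tau] and [n] alone, which makes the estimate uniform over all
    frames. *)
Lemma newton_block_estimate (K tau : R) : 0 <= K -> 0 <= tau ->
  exists2 C : R, 0 <= C & forall a b s t Z G (e : R), e <= 1 ->
    a *m a + b *m b = a -> a *m t - b *m s = s *m b + t - t *m a ->
    s *m Z + Z *m s = - t ->
    `|Z + b| <= K * `|s *m (Z + b) + (Z + b) *m s| ->
    `|t| <= tau -> `|b| <= e -> `|1%:M - a| <= e ->
    `|G| <= n%:R -> G *m (1%:M + Z *m Z) = 1%:M ->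
    `|block_mx G (- (G *m Z)) (- (Z *m G)) (Z *m G *m Z) -
      block_mx a b b (1%:M - a)| <= C * e ^+ 2.
Proof.
move=> K0 tau0; pose v : R := n%:R; have v0 : 0 <= v by [].
(* Coefficients of the successive bounds: [k1] for [1 - a], [k2] for [Z + b], [k3] for [Z] (first
   order in [e]), [k4] for [1 - G], [k5] for the off-diagonal blocks and [k6] for the lower right
   block. *)
pose k1 := 2 * v; pose k2 := K * (2 * v * (k1 * tau)); pose k3 := 1 + k2.
pose k4 := v * (v * (v * (k3 * k3))).
pose k5 := v * (k4 * k3) + k2.
pose k6 := v * (v * (k3 * v) * k3) + k1.
have k10 : 0 <= k1 by rewrite mulr_ge0.
have k20 : 0 <= k2 by rewrite !mulr_ge0.
have k30 : 0 <= k3 by rewrite addr_ge0.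
have k40 : 0 <= k4 by rewrite !mulr_ge0.
have k50 : 0 <= k5 by rewrite addr_ge0// !mulr_ge0.
have k60 : 0 <= k6 by rewrite addr_ge0// !mulr_ge0.
exists (k4 + k1 + k5 + k6); first by lra.
move=> a b s t Z G e e1 aab atbs LZ coer tt be ae Gn G1.
have e0 : 0 <= e by exact: le_trans be.
have ee : e ^+ 2 <= e by rewrite expr2 -[leRHS]mulr1 ler_wpM2l.
have e20 : 0 <= e ^+ 2 by rewrite exprn_ge0.
have h1 : `|1%:M - a| <= k1 * e ^+ 2.
  have -> : 1%:M - a = b *m b + (1%:M - a) *m (1%:M - a).
    have -> : b *m b = a - a *m a by rewrite -{1}aab addrAC subrr add0r.
    by rewrite !(mulmxBl, mulmxBr, mul1mx, mulmx1); mx_abel.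
  apply: (le_trans (ler_normD _ _)).
  apply: (le_trans (lerD (mx_norm_mul_le be be) (mx_norm_mul_le ae ae))).
  rewrite /k1 /v; lra.
have h2 : `|Z + b| <= k2 * e ^+ 2.
  have E2 : s *m (Z + b) + (Z + b) *m s = - ((1%:M - a) *m t + t *m (1%:M - a)).
    have sb : s *m b + b *m s = a *m t + t *m a - t.
      have -> : a *m t = s *m b + t - t *m a + b *m s by rewrite -atbs subrK.
      mx_abel.
    have -> : s *m (Z + b) + (Z + b) *m s =
        (s *m Z + Z *m s) + (s *m b + b *m s).
      by rewrite mulmxDl mulmxDr addrACA.
    by rewrite LZ sb !(mulmxBl, mulmxBr, mul1mx, mulmx1); mx_abel.
  apply: (le_trans coer); rewrite /k2 -mulrA ler_wpM2l// E2 normrN.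
  apply: (le_trans (ler_normD _ _)).
  apply: (le_trans (lerD (mx_norm_mul_le h1 tt) (mx_norm_mul_le tt h1))).
  rewrite -/v; lra.
have h3 : `|Z| <= k3 * e.
  have -> : Z = (Z + b) - b by rewrite addrK.
  apply: (le_trans (ler_normB _ _)).
  have := ler_wpM2l k20 ee; rewrite /k3 => h; lra.
have ZZ := mx_norm_mul_le h3 h3.
have h4 : `|1%:M - G| <= k4 * e ^+ 2.
  have -> : 1%:M - G = G *m (Z *m Z) by rewrite -G1 mulmxDr mulmx1 addrAC subrr add0r.
  apply: (le_trans (mx_norm_mul_le Gn ZZ)).
  rewrite /k4 /v; lra.
(* The product of a second-order and a first-order bound is cubic; [e <= 1] reduces it to a
   quadratic one. *)
have h5 : v * (k4 * e ^+ 2 * (k3 * e)) <= v * (k4 * k3) * e ^+ 2.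
  have w : 0 <= v * (k4 * k3) * e ^+ 2 by rewrite !mulr_ge0.
  have := ler_wpM2l w e1; lra.
have k1e : 0 <= k1 * e ^+ 2 by rewrite mulr_ge0.
have k4e : 0 <= k4 * e ^+ 2 by rewrite mulr_ge0.
have k5e : 0 <= k5 * e ^+ 2 by rewrite mulr_ge0.
have k6e : 0 <= k6 * e ^+ 2 by rewrite mulr_ge0.
rewrite opp_block_mx add_block_mx; apply: mx_norm_block.
- by rewrite !mulr_ge0//; lra.
- have -> : G - a = (1%:M - a) - (1%:M - G) by mx_abel.
  apply: (le_trans (ler_normB _ _)); lra.
- have -> : - (G *m Z) - b = (1%:M - G) *m Z - (Z + b).
    by rewrite mulmxBl mul1mx; mx_abel.
  apply: (le_trans (ler_normB _ _)).
  have := mx_norm_mul_le h4 h3; rewrite -/v /k5 in k5e * => h; lra.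
- have -> : - (Z *m G) - b = Z *m (1%:M - G) - (Z + b).
    by rewrite mulmxBr mulmx1; mx_abel.
  apply: (le_trans (ler_normB _ _)).
  have := mx_norm_mul_le h3 h4; rewrite -/v /k5 in k5e * => h; lra.
- apply: (le_trans (ler_normB _ _)).
  have := mx_norm_mul_le (mx_norm_mul_le h3 Gn) h3.
  rewrite -/v /k6 in k6e * => h; lra.
Qed.

(** * The orthogonal QR factor and the projection it produces *)

Section QR.
Variables Z U : 'M[R]_n.
Hypotheses (Zs : Z^T = Z) (qr : qr_triangular Z U).
Let V := invmx U.

Let uU : U \in unitmx.
Proof.
have [_ _ UU] := qr.
have : 1%:M + Z *m Z \in unitmx by rewrite -{2}Zs unitmx_add1_gram.
by rewrite -UU unitmx_mul => /andP[].
Qed.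

Let VZV : V^T *m (1%:M + Z *m Z) *m V = 1%:M.
Proof.
have [_ _ <-] := qr.
by rewrite mulmxA -trmx_mul mulmxV// trmx1 mul1mx mulmxV.
Qed.

(** Since [U^T U = 1 + Z^2], the product [V V^T] is the inverse of [1 + Z^2]; it is the matrix [G]
    of the block estimate. *)
Lemma qr_gram_inv : V *m V^T *m (1%:M + Z *m Z) = 1%:M.
Proof.
have [_ _ <-] := qr.
by rewrite -mulmxA (mulmxA V^T) -trmx_mul mulmxV// trmx1 mul1mx mulVmx.
Qed.

Lemma qr_orthosymplectic : orthosymplectic (qr_orthogonal Z U).
Proof.
split; last by rewrite /qr_orthogonal mul_Jmx_block mul_block_Jmx.
rewrite /qr_orthogonal -/V tr_block_mx mulmx_block [(- _)^T]raddfN/= !trmx_mul Zs.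
have h : V^T *m V + V^T *m Z *m (Z *m V) = 1%:M.
  by rewrite -VZV mulmxDr mulmx1 mulmxDl !mulmxA.
rewrite !(mulNmx, mulmxN) opprK h [_ *m (Z *m V) + V^T *m V]addrC h.
by rewrite !mulmxA !subrr -scalar_mx_block.
Qed.

Lemma qr_proj : qr_orthogonal Z U *m E *m (qr_orthogonal Z U)^T =
  block_mx (V *m V^T) (- (V *m V^T *m Z)) (- (Z *m (V *m V^T)))
    (Z *m (V *m V^T) *m Z).
Proof.
rewrite /qr_orthogonal -/V tr_block_mx !mulmx_block [(- _)^T]raddfN/= !trmx_mul Zs.
rewrite !(mul0mx, mulmx0, mulmx1, addr0, mulNmx, mulmxN, opprK).
by rewrite !mulmxA.
Qed.

(** The matrix [V] is a block of an orthogonal matrix, so its entries are at most 1 in absolute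
    value. *)
Lemma qr_gram_norm : `|V *m V^T| <= n%:R.
Proof.
have V1 : `|V| <= 1.
  have := orthosymplectic_norm qr_orthosymplectic; apply: le_trans.
  by rewrite -[V](block_mxKul _ (Z *m V) (- (Z *m V)) V) mx_norm_ulsubmx.
by rewrite (le_trans (mx_norm_mul_le V1 (_ : `|V^T| <= 1)))// ?mx_norm_tr// !mulr1.
Qed.

End QR.

(** * One step of the algorithm *)

Lemma orthosymplectic_newton_step A T T' :
  orthosymplectic T -> newton_step A T T' -> orthosymplectic T'.
Proof.
move=> oT [Z [U [[Zs _] qr TE]]].
have oQ := qr_orthosymplectic Zs qr.
have T'E : T' = (qr_orthogonal Z U)^T *m T by rewrite -[T']trmxK TE trmx_mul trmxK.
split.
  rewrite TE T'E mulmxA -(mulmxA T^T) (orthosymplectic_mulTV oQ) mulmx1.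
  exact: orthosymplectic_mulVT.
by have [_ h] := oT; rewrite T'E mulmxA (orthosymplectic_Jmx_tr oQ) -!mulmxA h.
Qed.

(** Conjugation by [T] moves everything to the frame where the current projection is [diag (1, 0)].
    Coercivity gives solvability and uniqueness there, and the block estimate is conjugated back. *)
Lemma newton_step_quadratic A P : LG P -> A^T = A -> J *m A = - (A *m J) ->
  A *m P = P *m A ->
  (forall X, tangent_LG P X ->
    (P *m A + A *m P - A) *m X + X *m (P *m A + A *m P - A) = 0 -> X = 0) ->
  exists C delta : R, [/\ 0 <= C, 0 < delta & forall T, orthosymplectic T ->
    `|proj_of T - P| <= delta ->
    [/\ exists T', newton_step A T T',
        exists! Z, lyapunov_solution A T Z &
        forall T', newton_step A T T' ->
          `|proj_of T' - P| <= C * `|proj_of T - P| ^+ 2]].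
Proof.
move=> LGP As AJ AP inj.
have [K [d [K0 d0 coer]]] := lyapunov_coercive_near LGP As AJ inj.
have [C C0 est] := newton_block_estimate K0
  (mulr_ge0 (exprn_ge0 2 (ler0n R (n + n))) (normr_ge0 A)).
have N20 : 0 <= N ^+ 2 by rewrite exprn_ge0.
(* The outer [N ^+ 2] pays for conjugating back and the squared one for [e = N ^+ 2 * dp]. The
   second bound in the minimum ensures [e <= 1]. *)
exists (N ^+ 2 * (C * (N ^+ 2) ^+ 2)), (Num.min d (N ^+ 2 + 1)^-1).
split=> [||T oT]; first by rewrite !mulr_ge0// exprn_ge0.
  by rewrite lt_min d0 invr_gt0 ltr_wpDl.
rewrite le_min => /andP[pd pN]; have {coer} coer := coer T oT pd.
have [s [t [ss ts BE]]] : exists s t, [/\ s^T = s, t^T = t &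
    T *m A *m T^T = block_mx s t t (- s)].
  apply: hamiltonian_blocks; first by rewrite !trmx_mul trmxK As mulmxA.
  by rewrite conj_Jmx// conj_mulJmx// AJ mulmxN mulNmx.
rewrite BE block_mxKul in coer.
have lyapE Z : lyapunov_solution A T Z <-> Z^T = Z /\ s *m Z + Z *m s = - t.
  by rewrite /lyapunov_solution BE block_mxKul block_mxKur.
have Linj W : W^T = W -> s *m W + W *m s = 0 -> W = 0.
  move=> Ws LW; have := coer W Ws; rewrite LW normr0 mulr0 normr_le0.
  by move/eqP.
have [Z [Zs LZ]] := lyapunov_exists ss ts Linj.
have Zuniq Z' : lyapunov_solution A T Z' -> Z' = Z.
  move=> /lyapE[Zs' LZ']; apply/eqP; rewrite -subr_eq0; apply/eqP.
  apply: Linj; first by rewrite linearB/= Zs Zs'.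
  rewrite mulmxBl mulmxBr -[RHS](subrr (- t)) -{1}LZ' -LZ; mx_abel.
split.
- have [U [U1 U2 U3]] := cholesky (posdefmx_add1_sqr Zs).
  exists (T^T *m qr_orthogonal Z U)^T, Z, U; split=> //; last by rewrite trmxK.
  by apply/lyapE.
- by exists Z; split=> [|Z' /Zuniq ->//]; apply/lyapE.
move=> T' [Z' [U [/Zuniq -> {Z'} qr TE]]].
have oQ := qr_orthosymplectic Zs qr.
pose Q := qr_orthogonal Z U; pose Pi := T *m P *m T^T.
have JPi : J *m Pi = J - Pi *m J.
  rewrite /Pi conj_Jmx// conj_mulJmx// LG_Jmx// mulmxBr mulmxBl.
  congr (_ - _); have [_ h] := oT.
  by rewrite -h -mulmxA orthosymplectic_mulTV// mulmx1.
have [Ps PP _ _] := LGP.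
have [a [b PiE]] := lagrangian_blocks JPi.
have PiPi : Pi *m Pi = Pi by rewrite /Pi conj_mul// PP.
have PiB : Pi *m (T *m A *m T^T) = T *m A *m T^T *m Pi.
  by rewrite /Pi !conj_mul// AP.
have aab : a *m a + b *m b = a.
  by move: PiPi; rewrite PiE mulmx_block => /eq_block_mx[].
have bs : b^T = b.
  have : Pi^T = Pi by rewrite /Pi !trmx_mul trmxK Ps mulmxA.
  by rewrite PiE tr_block_mx => /eq_block_mx[].
(* The upper right block of the commutation of [Pi] with the transformed [A]. *)
have atbs : a *m t - b *m s = s *m b + t - t *m a.
  move: PiB; rewrite PiE BE !mulmx_block => /eq_block_mx[_ + _ _].
  by rewrite mulmxN mulmxBr mulmx1 addrA.
have pE : T *m proj_of T *m T^T = E by rewrite /proj_of conj_trK.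
set dp := `|proj_of T - P|.
pose e := N ^+ 2 * dp.
have PiEe : `|Pi - E| <= e.
  by rewrite -pE /Pi -mulmxBl -mulmxBr /e /dp distrC conj_norm.
have e1 : e <= 1.
  apply: (le_trans (ler_wpM2l N20 pN)).
  by rewrite ler_pdivrMr ?ltr_wpDl// mul1r lerDl.
have PiEE : Pi - E = block_mx (a - 1%:M) b b (1%:M - a).
  by rewrite PiE opp_block_mx add_block_mx !subr0.
have be : `|b| <= e.
  apply: (le_trans _ PiEe).
  by rewrite PiEE; have := mx_norm_ursubmx (block_mx (a - 1%:M) b b (1%:M - a));
    rewrite block_mxKur.
have ae : `|1%:M - a| <= e.
  apply: (le_trans _ PiEe); rewrite distrC.
  by rewrite PiEE; have := mx_norm_ulsubmx (block_mx (a - 1%:M) b b (1%:M - a));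
    rewrite block_mxKul.
have tt : `|t| <= N ^+ 2 * `|A|.
  apply: (le_trans _ (conj_norm oT A)).
  by rewrite BE; have := mx_norm_ursubmx (block_mx s t t (- s)); rewrite block_mxKur.
have G1 := qr_gram_inv Zs qr.
have Zb : (Z + b)^T = Z + b by rewrite linearD/= Zs bs.
have := est a b s t Z _ e e1 aab atbs LZ (coer _ Zb) tt be ae
  (qr_gram_norm Zs qr) G1.
rewrite -(qr_proj U Zs) -PiE => key.
have -> : proj_of T' - P = T^T *m (Q *m E *m Q^T - Pi) *m T.
  rewrite mulmxBr mulmxBl conjK//; congr (_ - _).
  have T'E : T' = Q^T *m T by rewrite -[T']trmxK TE trmx_mul trmxK.
  by rewrite /proj_of TE T'E !mulmxA.
apply: (le_trans (conj_tr_norm oT _)).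
by apply: (le_trans (ler_wpM2l N20 key)); rewrite /e exprMn !mulrA.
Qed.

End NewtonStep.

(** * Iteration of the step in an invariant ball *)

Theorem theorem10 (R : realType) (n : nat) (n_ge1 : (1 <= n)%N)
    (A : 'M[R]_(n + n)) (A_symham : symmetric_hamiltonian A)
    (Pstar : 'M[R]_(n + n))
    (Pstar_crit :
       nondegenerate_critical_point (@LG R n) (rayleigh A) Pstar) :
  locally_quadratically_convergent A Pstar.
Proof.
have crit : critical_point (@LG R n) (rayleigh A) Pstar by case: Pstar_crit.
have LGP : LG Pstar by case: crit.
have [C [d [C0 d0 step]]] := newton_step_quadratic LGP
  (symmetric_hamiltonian_tr A_symham) (symmetric_hamiltonian_Jmx A_symham)
  (critical_point_comm A_symham crit)
  (fun X => @nondegenerate_injective R n A Pstar X A_symham Pstar_crit).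
(* The second bound gives [C * r <= 1/2], so each step at least halves the error and the ball of
   radius [r] is invariant. *)
pose r := Num.min d (2 * (C + 1))^-1.
have r0 : 0 < r by rewrite lt_min d0 invr_gt0 mulr_gt0// ltr_wpDl.
have rd : r <= d by rewrite ge_min lexx.
have Cr : C * r <= 2^-1.
  apply: (@le_trans _ _ (C * (2 * (C + 1))^-1)).
    by rewrite ler_wpM2l// ge_min lexx orbT.
  rewrite invfM mulrCA -[leRHS]mulr1 ler_wpM2l// ?invr_ge0//.
  by rewrite ler_pdivrMr ?ltr_wpDl// mul1r lerDl.
pose good T := orthosymplectic T /\ `|proj_of T - Pstar| <= r.
have half T T' : good T -> newton_step A T T' ->
    good T' /\ `|proj_of T' - Pstar| <= 2^-1 * `|proj_of T - Pstar|.
  move=> [oT Tr] TT'; have [_ _ /(_ _ TT') q] := step T oT (le_trans Tr rd).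
  have h : `|proj_of T' - Pstar| <= 2^-1 * `|proj_of T - Pstar|.
    apply: (le_trans q); rewrite expr2 mulrA ler_wpM2r//.
    by apply: (le_trans _ Cr); rewrite ler_wpM2l.
  split=> //; split; first exact: orthosymplectic_newton_step TT'.
  apply: (le_trans h); apply: (le_trans _ Tr).
  by rewrite -[leRHS]mul1r ler_wpM2r// invf_le1// ler1n.
exists [set P | LG P /\ `|P - Pstar| < r], C; split.
- by move=> P [].
- rewrite /within /=; apply/nbhs_ballP; exists r => //= P.
  by rewrite mx_norm_ball /ball_/= distrC => h LGP'; split.
move=> T0 /OSp_orthosymplectic oT0 [_ T0r].
have good0 : good T0 by split=> //; exact: ltW.
split.
  (* The choice function must be total; outside [good] its value is a dummy, which the iteration
     from [T0] never meets. *)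
  have nextP T : exists T', good T -> newton_step A T T'.
    have [gT|nT] := pselect (good T); last by exists T.
    have [oT Tr] := gT.
    by have [[T' h] _ _] := step T oT (le_trans Tr rd); exists T'.
  have [next nextE] := choice nextP.
  exists (fun j => iter j next T0); split=> // j.
  suff : good (iter j next T0) by exact: nextE.
  elim: j => // j ih; exact: (half _ _ ih (nextE _ ih)).1.
move=> T [TE0 run].
have goodT j : good (T j).
  by elim: j => [|j ih]; [rewrite TE0|exact: (half _ _ ih (run j)).1].
split=> [j||j].
- by have [oT Tr] := goodT j; have [] := step (T j) oT (le_trans Tr rd).
- have bound j : `|proj_of (T j) - Pstar| <= r * 2^-1 ^+ j.
    elim: j => [|j ih]; first by rewrite expr0 mulr1; case: (goodT 0%N).
    apply: (le_trans (half _ _ (goodT j) (run j)).2).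
    by rewrite exprS mulrCA ler_wpM2l// invr_ge0.
  apply/cvgrPdist_le => /= eps eps0.
  have cv : (fun j => r * 2^-1 ^+ j) @ \oo --> (0 : R).
    rewrite -[0](mulr0 r); apply: cvgMr; apply: cvg_expr.
    by rewrite ger0_norm ?invr_ge0// invf_lt1// ltr1n.
  near=> j; rewrite distrC; apply: (le_trans (bound j)).
  have : `|0 - r * 2^-1 ^+ j| <= eps by near: j; move/cvgrPdist_le : cv; exact.
  by rewrite sub0r normrN; apply: le_trans; exact: ler_norm.
- by have [oT Tr] := goodT j; have [_ _] := step (T j) oT (le_trans Tr rd); exact.
Unshelve. all: by end_near. Qed.
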